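(* Let $(G,u)$ and $(H,v)$ be approximately divisible dimension groups with traces $\sigma$ and $\tau$ respectively. If $\sigma\otimes 1_{\mathbb Q}$ on $G\otimes\mathbb Q$ and $\tau\otimes 1_{\mathbb Q}$ on $H\otimes\mathbb Q$ are both order unit good, then the trace $\sigma\otimes\tau$ on $(G\otimes H,u\otimes v)$ is order unit good.
   Context: A dimension group is a directed unperforated partially ordered abelian group with Riesz interpolation; $u\in G^+$ is an order unit if for every $g\in G$ there is a positive integer $K$ with $-Ku\le g\le Ku$. A trace is a nonzero positive group homomorphism $\tau:G\to\mathbb R$; it is order unit good if for every order unit $b$ of $G$ and every $a'\in G$ with $0\le\tau(a')\le\tau(b)$ there is $a\in G$ with $0\le a\le b$ and $\tau(a)=\tau(a')$. $S(G,u)$ is the compact convex set of traces with $\tau(u)=1$ (point-open topology), $\mathrm{Aff}\,S(G,u)$ the Banach space of continuous affine real functions on it, and $g\mapsto\hat g$, $\hat g(\tau)=\tau(g)$, the affine representation. $(G,u)$ is approximately divisible if the image of $G$ in $\mathrm{Aff}\,S(G,u)$ is norm-dense. Tensor products are over $\mathbb Z$; $G\otimes H$ is ordered by the positive cone $\{\sum g_i\otimes h_i: g_i\in G^+,h_i\in H^+\}$ (finite sums), and $u\otimes v$ is an order unit. $G\otimes\mathbb Q$ is the divisible hull, ordered in the same way ($\mathbb Q$ with its usual order); $\sigma\otimes1_{\mathbb Q}$ is the extension $g\otimes q\mapsto q\sigma(g)$; $(\sigma\otimes\tau)(g\otimes h)=\sigma(g)\tau(h)$. *)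

(* Defs.v *)
From HB Require Import structures.
From mathcomp Require Import all_boot all_order all_algebra generic_quotient.
From mathcomp Require Import all_classical all_reals all_analysis.
From mathcomp Require Import freeg.

Set Implicit Arguments.
Unset Strict Implicit.
Unset Printing Implicit Defensive.

Import Order.TTheory GRing.Theory Num.Theory.
Import numFieldNormedType.Exports.

Local Open Scope classical_set_scope.
Local Open Scope ring_scope.
Local Open Scope quotient_scope.

(* Tensor product over the integers: the quotient of the free abelian group on
   G * H by the subgroup generated by the bilinearity relations.              *)

Section TensorProduct.
Variables G H : zmodType.

Inductive tensor_rel : {freeg (G * H)%type} -> Prop :=
| tensor_rel0 : tensor_rel 0
| tensor_relB x y of tensor_rel x & tensor_rel y : tensor_rel (x - y)
| tensor_rell g g' h :
    tensor_rel (<< (g + g', h) >> - << (g, h) >> - << (g', h) >>)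
| tensor_relr g h h' :
    tensor_rel (<< (g, h + h') >> - << (g, h) >> - << (g, h') >>).

Lemma tensor_relN x : tensor_rel x -> tensor_rel (- x).
Proof. by move=> rx; rewrite -sub0r; apply: tensor_relB => //; constructor. Qed.

Lemma tensor_relD x y : tensor_rel x -> tensor_rel y -> tensor_rel (x + y).
Proof. by move=> rx ry; rewrite -[y]opprK; apply/tensor_relB/tensor_relN. Qed.

Definition tensor_eq (x y : {freeg (G * H)%type}) : bool :=
  `[< tensor_rel (x - y) >].

Lemma tensor_eq_refl : reflexive tensor_eq.
Proof. by move=> x; apply/asboolP; rewrite subrr; constructor. Qed.

Lemma tensor_eq_sym : symmetric tensor_eq.
Proof.
by move=> x y; apply/asboolP/asboolP => /tensor_relN; rewrite opprB.
Qed.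

Lemma tensor_eq_trans : transitive tensor_eq.
Proof.
move=> y x z /asboolP rxy /asboolP ryz; apply/asboolP.
by rewrite -(subrK y x) -addrA; apply: tensor_relD.
Qed.

Canonical tensor_equiv :=
  EquivRel tensor_eq tensor_eq_refl tensor_eq_sym tensor_eq_trans.

Definition tensor := {eq_quot tensor_eq}.
HB.instance Definition _ := Choice.on tensor.
HB.instance Definition _ := EqQuotient.on tensor.

Lemma tensor_piP x y :
  reflect (tensor_rel (x - y)) (\pi_tensor x == \pi_tensor y).
Proof. by rewrite piE; apply: asboolP. Qed.

Definition tensor_zero : tensor := \pi_tensor 0.
Definition tensor_opp (x : tensor) : tensor := \pi_tensor (- repr x).
Definition tensor_add (x y : tensor) : tensor := \pi_tensor (repr x + repr y).

Lemma repr_pi x : tensor_rel (repr (\pi_tensor x) - x).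
Proof. by apply/tensor_piP; rewrite reprK. Qed.

Lemma tensor_pi_opp x : tensor_opp (\pi_tensor x) = \pi_tensor (- x).
Proof.
apply/eqP/tensor_piP; rewrite -opprD; apply: tensor_relN.
exact: repr_pi.
Qed.

Lemma tensor_pi_add x y :
  tensor_add (\pi_tensor x) (\pi_tensor y) = \pi_tensor (x + y).
Proof.
apply/eqP/tensor_piP; rewrite opprD addrACA.
by apply: tensor_relD; apply: repr_pi.
Qed.

Lemma tensor_addA : associative tensor_add.
Proof.
move=> x y z; elim/quotW: x => x; elim/quotW: y => y; elim/quotW: z => z.
by rewrite (tensor_pi_add y z) (tensor_pi_add x y) !(tensor_pi_add _ z)
  (tensor_pi_add x (y + z)) addrA.
Qed.

Lemma tensor_addC : commutative tensor_add.
Proof.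
move=> x y; elim/quotW: x => x; elim/quotW: y => y.
by rewrite (tensor_pi_add x y) (tensor_pi_add y x) addrC.
Qed.

Lemma tensor_add0 : left_id tensor_zero tensor_add.
Proof. by move=> x; elim/quotW: x => x; rewrite (tensor_pi_add 0 x) add0r. Qed.

Lemma tensor_addN : left_inverse tensor_zero tensor_opp tensor_add.
Proof.
move=> x; elim/quotW: x => x.
by rewrite (tensor_pi_opp x) (tensor_pi_add (- x) x) addNr.
Qed.

HB.instance Definition _ := GRing.isZmodule.Build tensor
  tensor_addA tensor_addC tensor_add0 tensor_addN.

Lemma tensor_pi_zmod_morphism : zmod_morphism (\pi_tensor).
Proof. by move=> x y; rewrite -tensor_pi_add -tensor_pi_opp. Qed.

Definition tens (g : G) (h : H) : tensor := \pi_tensor << (g, h) >>.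

Lemma tensDl g g' h : tens (g + g') h = tens g h + tens g' h.
Proof.
rewrite [RHS]tensor_pi_add; apply/eqP/tensor_piP.
by rewrite opprD addrA; apply: tensor_rell.
Qed.

Lemma tensDr g h h' : tens g (h + h') = tens g h + tens g h'.
Proof.
rewrite [RHS]tensor_pi_add; apply/eqP/tensor_piP.
by rewrite opprD addrA; apply: tensor_relr.
Qed.

Definition biadditive (A : zmodType) (f : G -> H -> A) :=
  (forall h, {morph f^~ h : x y / x + y}) /\ (forall g, {morph f g : x y / x + y}).

Section Lift.
Variables (A : zmodType) (f : G -> H -> A).
Hypothesis f_biadd : biadditive f.

Definition tensor_prelift : {freeg (G * H)%type} -> zmodule A :=
  fglift (fun p : G * H => f p.1 p.2 : zmodule A).

Lemma tensor_preliftU g h : tensor_prelift << (g, h) >> = f g h.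
Proof. by rewrite /tensor_prelift liftU scale1r. Qed.

Lemma tensor_preliftB x y :
  tensor_prelift (x - y) = tensor_prelift x - tensor_prelift y.
Proof. exact: lift_is_additive. Qed.

Lemma tensor_prelift_rel x : tensor_rel x -> tensor_prelift x = 0.
Proof.
elim=> [|{}x y _ x0 _ y0|g g' h|g h h'].
- by rewrite -(subrr 0) tensor_preliftB subrr.
- by rewrite tensor_preliftB x0 y0 subr0.
- by rewrite !tensor_preliftB !tensor_preliftU f_biadd.1 addrAC addrK subrr.
- by rewrite !tensor_preliftB !tensor_preliftU f_biadd.2 addrAC addrK subrr.
Qed.

Definition tensor_lift_fun of biadditive f := fun x : tensor =>
  tensor_prelift (repr x) : A.

Lemma tensor_lift_pi x :
  tensor_lift_fun f_biadd (\pi_tensor x) = tensor_prelift x.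
Proof.
apply/eqP; rewrite -subr_eq0 -[_ - _]tensor_preliftB.
by rewrite tensor_prelift_rel//; apply: repr_pi.
Qed.

Lemma tensor_lift_zmod_morphism : zmod_morphism (tensor_lift_fun f_biadd).
Proof.
move=> x y; elim/quotW: x => x; elim/quotW: y => y.
by rewrite -tensor_pi_zmod_morphism !tensor_lift_pi tensor_preliftB.
Qed.

HB.instance Definition _ := GRing.isZmodMorphism.Build tensor A
  (tensor_lift_fun f_biadd) tensor_lift_zmod_morphism.

Definition tensor_lift : {additive tensor -> A} := tensor_lift_fun f_biadd.

Lemma tensor_liftE g h : tensor_lift (tens g h) = f g h.
Proof. by rewrite [LHS]tensor_lift_pi tensor_preliftU. Qed.

End Lift.
End TensorProduct.

(* The order of an abelian group is given by its positive cone P. *)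

Section OrderedGroups.
Variables (G : zmodType) (P : set G).

Definition cone_le (x y : G) : Prop := P (y - x).

Definition partial_order_cone : Prop :=
  [/\ P 0, forall x y, P x -> P y -> P (x + y)
    & forall x, P x -> P (- x) -> x = 0].

Definition directed : Prop :=
  forall x y, exists z, cone_le x z /\ cone_le y z.

Definition unperforated : Prop :=
  forall (n : nat) x, (0 < n)%N -> P (x *+ n) -> P x.

Definition Riesz_interpolation : Prop :=
  forall a1 a2 b1 b2,
    cone_le a1 b1 -> cone_le a1 b2 -> cone_le a2 b1 -> cone_le a2 b2 ->
    exists c, [/\ cone_le a1 c, cone_le a2 c, cone_le c b1 & cone_le c b2].

Definition dimension_group : Prop :=
  [/\ partial_order_cone, directed, unperforated & Riesz_interpolation].

Definition order_unit (u : G) : Prop :=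
  P u /\ forall g, exists K : nat,
    [/\ (0 < K)%N, cone_le (- (u *+ K)) g & cone_le g (u *+ K)].

End OrderedGroups.

Record trace (R : realType) (G : zmodType) (P : set G) := Trace {
  trace_fun :> {additive G -> R};
  trace_nonzero : exists g, trace_fun g != 0;
  trace_ge0 : forall g, P g -> 0 <= trace_fun g
}.

Section Traces.
Variables (R : realType) (G : zmodType) (P : set G).

Definition order_unit_good (t : trace R P) : Prop :=
  forall b a', order_unit P b -> 0 <= t a' <= t b ->
    exists a, [/\ P a, cone_le P a b & t a = t a'].

Definition state_space (u : G) : set {ptws G -> R} :=
  [set t | exists s : trace R P, s u = 1 /\ t = (s : G -> R)].

(* The elements of Aff S are total functions of which only the values on the
   convex set S are meaningful.                                             *)
Definition Aff (S : set {ptws G -> R}) : set ({ptws G -> R} -> R) :=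
  [set f | {within S, continuous f} /\
     forall s t (a : R), S s -> S t -> 0 <= a <= 1 ->
       f (fun g => a * s g + (1 - a) * t g) = a * f s + (1 - a) * f t].

Definition affine_rep (g : G) : {ptws G -> R} -> R := fun t => t g.

(* Norm density, for the supremum norm of Aff (state_space u), of the image of
   the affine representation.                                                *)
Definition approximately_divisible (u : G) : Prop :=
  forall f, Aff (state_space u) f -> forall e : R, 0 < e ->
    exists g, forall t, state_space u t -> `|f t - affine_rep g t| < e.

End Traces.

Definition tensor_cone (G H : zmodType) (P : set G) (Q : set H) :
    set (tensor G H) :=
  [set x | exists s : seq (G * H),
     (forall p, p \in s -> P p.1 /\ Q p.2) /\
     x = \sum_(p <- s) tens p.1 p.2].

Section TensorTrace.
Variables (R : realType) (G H : zmodType) (P : set G) (Q : set H).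
Variables (s : trace R P) (t : trace R Q).

Lemma tensor_trace_biadditive : biadditive (fun g h => s g * t h).
Proof. by split=> [h x y|g x y] /=; rewrite raddfD ?mulrDl ?mulrDr. Qed.

Let st := tensor_lift tensor_trace_biadditive.

Lemma tensor_trace_nonzero : exists x, st x != 0.
Proof.
have [g sg] := trace_nonzero s; have [h th] := trace_nonzero t.
by exists (tens g h); rewrite tensor_liftE mulf_neq0.
Qed.

Lemma tensor_trace_ge0 x : tensor_cone P Q x -> 0 <= st x.
Proof.
move=> [r [rPQ ->]]; rewrite raddf_sum big_seq; apply: sumr_ge0 => p /rPQ[Pp Qp].
by rewrite tensor_liftE mulr_ge0// trace_ge0.
Qed.

Definition tensor_trace : trace R (tensor_cone P Q) :=
  Trace tensor_trace_nonzero tensor_trace_ge0.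

Lemma tensor_traceE g h : tensor_trace (tens g h) = s g * t h.
Proof. exact: tensor_liftE. Qed.

End TensorTrace.

Definition rat_cone : set rat := [set q | 0 <= q].

Section RatTrace.
Variable R : realType.

Let ratrR : {additive rat -> R} := @ratr R.

Lemma rat_trace_nonzero : exists q, ratrR q != 0.
Proof. by exists 1; rewrite [X in X != 0]rmorph1 oner_neq0. Qed.

Lemma rat_trace_ge0 q : rat_cone q -> 0 <= ratrR q.
Proof. by move=> q0; rewrite -[ratrR q]/(ratr q) ler0q. Qed.

(* tensor_trace s rat_trace maps g (x) q to s g * ratr q: it is the extension
   of s to the divisible hull.                                              *)
Definition rat_trace : trace R rat_cone := Trace rat_trace_nonzero rat_trace_ge0.

End RatTrace.

(* Main.v *)
(* Write w = u (x) v and t = sigma (x) tau. Goodness of sigma (x) 1_Q makes every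
   element of G (x) Q, up to an arbitrarily small positive element, the sum of a
   rational multiple of u and of an element of the kernel of sigma; likewise
   for H. Hence every x in G (x) H is, rationally and up to a small multiple of
   w, a multiple of w plus an element of the subgroup generated by
   ker sigma (x) H and G (x) ker tau, and by approximate divisibility elements
   of that subgroup can be divided by integers, up to small errors, inside
   ker t. So if 0 < t a' < t b, subtracting an element of ker t from a' yields
   some a with a close to (t a' / t b) b, and some positive multiples of a and
   b - a dominate w.

   It remains to see that x >= 0 as soon as n x >= w. States of G (x) H are not
   needed: since H is torsion-free, an identity n y = sum_k e_k (x) f_k is
   witnessed by identities n y_j = sum_k c_kj e_k in G, and replacing e_k by n
   times an approximation of e_k / n expresses y as a positive element plus
   a sum of z_j (x) h_j with all z_j small. *)
From HB Require Import structures.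
Require Import Defs.
From mathcomp Require Import all_boot all_order all_algebra generic_quotient.
From mathcomp Require Import all_classical all_reals all_analysis.
From mathcomp Require Import freeg ring lra.

Set Implicit Arguments.
Unset Strict Implicit.
Unset Printing Implicit Defensive.

Import Order.TTheory GRing.Theory Num.Theory.
Import numFieldNormedType.Exports.

Local Open Scope classical_set_scope.
Local Open Scope ring_scope.
Local Open Scope quotient_scope.

(** * Identities in abelian groups *)

Inductive zexpr : Type :=
| ZVar of nat
| ZZero
| ZAdd of zexpr & zexpr
| ZOpp of zexpr
| ZMuln of zexpr & nat
| ZMulz of zexpr & int.

Fixpoint zeval (V : zmodType) (x : seq V) (e : zexpr) : V :=
  match e with
  | ZVar i => x`_i
  | ZZero => 0
  | ZAdd a b => zeval x a + zeval x b
  | ZOpp a => - zeval x a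
  | ZMuln a n => zeval x a *+ n
  | ZMulz a z => zeval x a *~ z
  end.

Fixpoint zcoef (e : zexpr) (i : nat) : int :=
  match e with
  | ZVar j => if j == i then 1 else 0
  | ZZero => 0
  | ZAdd a b => zcoef a i + zcoef b i
  | ZOpp a => - zcoef a i
  | ZMuln a n => zcoef a i * n%:Z
  | ZMulz a z => zcoef a i * z
  end.

Lemma zeval_coef (V : zmodType) (x : seq V) (e : zexpr) :
  zeval x e = \sum_(i < size x) x`_i *~ zcoef e i.
Proof.
elim: e => [j||a IHa b IHb|a IHa|a IHa n|a IHa z] /=.
- have [jx|xj] := ltnP j (size x).
    rewrite (bigD1 (Ordinal jx))//= eqxx mulr1z big1 ?addr0// => i.
    by rewrite -val_eqE /= eq_sym => /negbTE->; rewrite mulr0z.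
  rewrite nth_default// big1// => i _; case: eqP => [ij|_]; last by rewrite mulr0z.
  by move: xj; rewrite ij leqNgt ltn_ord.
- by rewrite big1// => i _; rewrite mulr0z.
- by rewrite IHa IHb -big_split; apply: eq_bigr => i _; rewrite mulrzDr.
- by rewrite IHa -sumrN; apply: eq_bigr => i _; rewrite mulrNz.
- by rewrite IHa -sumrMnl; apply: eq_bigr => i _; rewrite mulrzA -pmulrn.
- by rewrite IHa mulrz_suml; apply: eq_bigr => i _; rewrite mulrzA.
Qed.

(** A recursive conjunction, so that for a concrete list of atoms it unfolds to finitely many
    integer identities, each left to [ring]. *)
Fixpoint zcoef_eq (n : nat) (a b : zexpr) : Prop :=
  match n with
  | 0%N => True
  | n'.+1 => zcoef a n' = zcoef b n' /\ zcoef_eq n' a b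
  end.

Lemma zeval_eq (V : zmodType) (x : seq V) (a b : zexpr) :
  zcoef_eq (size x) a b -> zeval x a = zeval x b.
Proof.
move=> eqab; rewrite !zeval_coef; apply: eq_bigr => i _; congr (_ *~ _).
by elim: (size x) i eqab => [[]//|n IHn] i /= [ab /IHn{}IHn];
  case: (unliftP ord_max i) => [j|] ->; rewrite ?lift_max.
Qed.

(* Atoms are compared up to conversion because the same element often occurs
   with different inferred algebraic structures. *)
Ltac zindex x l :=
  match l with
  | ?y :: _ => let _ := match goal with _ => unify x y end in constr:(0%N)
  | _ :: ?l' => let n := zindex x l' in constr:(n.+1)
  end.

Ltac zinsert x l :=
  match goal with
  | _ => let _ := zindex x l in l
  | _ => constr:(x :: l)
  end.

Ltac zatoms e l :=
  lazymatch e with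
  | @GRing.add _ ?a ?b => let l' := zatoms a l in zatoms b l'
  | @GRing.opp _ ?a => zatoms a l
  | @GRing.zero _ => l
  | @GRing.natmul _ ?a _ => zatoms a l
  | @intmul _ ?a _ => zatoms a l
  | _ => zinsert e l
  end.

Ltac zreify e l :=
  lazymatch e with
  | @GRing.add _ ?a ?b =>
      let a' := zreify a l in let b' := zreify b l in constr:(ZAdd a' b')
  | @GRing.opp _ ?a => let a' := zreify a l in constr:(ZOpp a')
  | @GRing.zero _ => constr:(ZZero)
  | @GRing.natmul _ ?a ?n => let a' := zreify a l in constr:(ZMuln a' n)
  | @intmul _ ?a ?z => let a' := zreify a l in constr:(ZMulz a' z)
  | _ => let i := zindex e l in constr:(ZVar i)
  end.

(* Identities between Z-linear combinations, reduced to identities between the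
   integer coefficients of each atom. *)
Ltac zmodule :=
  lazymatch goal with
  | |- @eq ?T ?a ?b =>
      let l := zatoms a (@nil T) in
      let l := zatoms b l in
      let a' := zreify a l in
      let b' := zreify b l in
      refine (@zeval_eq _ l a' b' _);
      rewrite /=; repeat split; ring
  end.

(** * Vanishing of sums of pure tensors *)

Definition torsion_free (V : zmodType) : Prop :=
  forall (n : nat) (x : V), (0 < n)%N -> x *+ n = 0 -> x = 0.

Lemma torsion_freez (V : zmodType) (z : int) (x : V) :
  torsion_free V -> z != 0 -> x *~ z = 0 -> x = 0.
Proof.
move=> tfV; case: z => [[|n]|n] //= _ => [|/eqP]; first exact: tfV.
by rewrite NegzE mulrNz oppr_eq0 => /eqP; apply: tfV.
Qed.

Definition zspan (V : zmodType) (m : nat) (e : 'I_m -> V) : set V :=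
  [set x | exists c : 'I_m -> int, x = \sum_j e j *~ c j].

Definition zfree (V : zmodType) (m : nat) (e : 'I_m -> V) : Prop :=
  forall c : 'I_m -> int, \sum_j e j *~ c j = 0 -> forall j, c j = 0.

Lemma zspan_sub (V : zmodType) (m n : nat) (e : 'I_m -> V) (f : 'I_n -> V) :
  (forall j, zspan f (e j)) -> zspan e `<=` zspan f.
Proof.
move=> /choice[d ed] _ [c ->]; exists (fun i => \sum_j d j i * c j).
under eq_bigr do rewrite ed mulrz_suml.
rewrite exchange_big; apply: eq_bigr => i _.
by rewrite mulrz_sumr; apply: eq_bigr => j _; rewrite mulrzA.
Qed.

Lemma zspan_mem (V : zmodType) (m : nat) (e : 'I_m -> V) (i : 'I_m) :
  zspan e (e i).
Proof.
exists (fun j => (j == i)%:R); rewrite (bigD1 i)//= eqxx mulr1z big1 ?addr0//.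
by move=> j /negbTE->; rewrite mulr0z.
Qed.

(* By the Smith normal form, a nontrivial relation becomes, after a unimodular
   change of generators, a multiple of a single one, which then vanishes. *)
Lemma zspan_free (V : zmodType) (m : nat) (e : 'I_m -> V) :
  torsion_free V ->
  exists n (f : 'I_n -> V), zfree f /\ zspan e `<=` zspan f.
Proof.
move=> tfV; elim: m e => [|m IHm] e; first by exists 0%N, e; split=> [c _ []|x].
have [fe|] := pselect (zfree e); first by exists m.+1, e; split=> [//|x].
move=> /existsNP[c] /not_implyP[ec0] /existsNP[j0 /eqP cj0].
have [L Lu [S Su [d _ cLDS]]] := int_Smith_normal_form (\row_j c j).
(* Since [c] is a single row, only the first diagonal entry survives, and [c] is [b] times the first
   row of the unimodular [S]. *)
pose b := L 0 0 * d`_0.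
have cE j : c j = b * S 0 j.
  have := congr1 (fun M : 'M[int]_(1, m.+1) => M 0 j) cLDS; rewrite !mxE => ->.
  rewrite big_ord_recl big1 => [|i _].
    by rewrite addr0 mxE big_ord1 mxE eqxx mulr1n.
  by rewrite mxE big_ord1 mxE mulr0n mulr0 mul0r.
clearbody b.
have b_neq0 : b != 0 by apply: contra_neq cj0 => b0; rewrite cE b0 mul0r.
(* In the generators [f] the relation reads b f_0 = 0; [invmx S] then recovers every [e j] from the
   [f i] with i > 0. *)
pose f i := \sum_j e j *~ S i j.
have f0 : f ord0 = 0.
  apply: (torsion_freez tfV b_neq0); rewrite /f.
  rewrite mulrz_suml -[RHS]ec0; apply: eq_bigr => j _.
  by rewrite cE mulrC mulrzA.
have ef j : zspan (f \o fintype.lift ord0) (e j).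
  exists (fun i => invmx S j (fintype.lift ord0 i)).
  suff -> : e j = \sum_i f i *~ invmx S j i.
    by rewrite big_ord_recl f0 mul0rz add0r.
  under eq_bigr do rewrite mulrz_suml.
  rewrite exchange_big; move=> /=.
  under eq_bigr => k _ do under eq_bigr => i _ do rewrite -mulrzA mulrC.
  under eq_bigr => k _ do rewrite -mulrz_sumr.
  have SS k : \sum_i invmx S j i * S i k = (k == j)%:R.
    have := congr1 (fun M : 'M[int]_m.+1 => M j k) (mulVmx Su).
    by rewrite !mxE eq_sym.
  under eq_bigr do rewrite SS.
  rewrite (bigD1 j)//= eqxx mulr1z big1 ?addr0//.
  by move=> k /negbTE->; rewrite mulr0z.
have [n [g [fg sg]]] := IHm (f \o fintype.lift ord0).
by exists n, g; split=> //; apply: subset_trans sg; apply: zspan_sub.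
Qed.

Section Coordinates.
Variables (V : zmodType) (m : nat) (e : 'I_m -> V).

(** A choice of coordinates, with default 0 outside the span. When [e] is free they are unique on
    the span, hence additive there. *)
Definition zcoord (x : V) : 'I_m -> int :=
  if pselect (zspan e x) is left h then sval (cid h) else fun=> 0.

Lemma zcoordE (x : V) : zspan e x -> x = \sum_j e j *~ zcoord x j.
Proof. by rewrite /zcoord; case: pselect => // h _; case: cid. Qed.

Lemma zcoordD (x y : V) : zfree e -> zspan e x -> zspan e y ->
  forall j, zcoord (x + y) j = zcoord x j + zcoord y j.
Proof.
move=> fe ex ey j; apply/eqP; rewrite -subr_eq0; apply/eqP.
move: j; apply: fe; under eq_bigr do rewrite mulrzBr mulrzDr.
rewrite big_split/= sumrN big_split/= -!zcoordE ?subrr//.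
have [[a {1}->] [b {1}->]] := (ex, ey).
by exists (fun j => a j + b j); rewrite -big_split; apply: eq_bigr => j _;
  rewrite mulrzDr.
Qed.

End Coordinates.

Lemma fglift0 (K : choiceType) (M : lmodType int) (f : K -> M) :
  fglift f (0 : {freeg K}) = 0.
Proof. by rewrite -(subrr 0) lift_is_additive subrr. Qed.

Lemma fgliftD (K : choiceType) (M : lmodType int) (f : K -> M)
    (x y : {freeg K}) : fglift f (x + y) = fglift f x + fglift f y.
Proof.
by rewrite -{1}[y]opprK lift_is_additive -[- y]sub0r lift_is_additive fglift0
  sub0r opprK.
Qed.

Section TensorZero.
Variables G H : zmodType.

(** Contraction of g (x) h to h_j g, with h_j the j-th coordinate of h. It is defined on the free
    abelian group because h_j is only known to be additive on the span of [e]. *)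
Definition zcoord_contract (m : nat) (e : 'I_m -> H) (j : 'I_m) :
    {freeg (G * H)%type} -> zmodule G :=
  fglift (fun p : G * H => p.1 *~ zcoord e p.2 j : zmodule G).

(* An instance of a bilinearity relation in the right variable only involves
   finitely many elements of H, hence is preserved once e spans them. *)
Lemma tensor_rel_contract (x : {freeg (G * H)%type}) : tensor_rel x ->
  exists L : seq H, forall m (e : 'I_m -> H), zfree e ->
    (forall h, h \in L -> zspan e h) -> forall j, zcoord_contract e j x = 0.
Proof.
elim=> [|{}x y _ [L xL] _ [M yM]|g g' h|g h h'].
- by exists nil => m e _ _ j; rewrite [LHS]fglift0.
- exists (L ++ M) => m e fe eLM j; rewrite [LHS]lift_is_additive.
  rewrite -!/(zcoord_contract e j _) xL ?yM ?subr0// => h hL; apply: eLM;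
    by rewrite mem_cat hL ?orbT.
- exists nil => m e fe _ j; rewrite [LHS]lift_is_additive lift_is_additive.
  by rewrite !liftU !scale1r /= mulrzDl addrAC addrK subrr.
- exists [:: h; h'] => m e fe ehh' j.
  rewrite [LHS]lift_is_additive lift_is_additive !liftU !scale1r /=.
  rewrite zcoordD ?mulrzDr; first by rewrite addrAC addrK subrr.
  + exact: fe.
  + by apply: ehh'; rewrite !inE eqxx.
  + by apply: ehh'; rewrite !inE eqxx orbT.
Qed.

(** The second components, together with the finitely many elements of [H] used in deriving the
    relation, lie in the span of a free family. Contracting along its coordinates gives the
    identities in [G]. *)
Lemma tens_sum_eq0 (s : seq (G * H)) : torsion_free H ->
  \sum_(p <- s) tens p.1 p.2 = 0 ->
  exists m (e : 'I_m -> H) (c : H -> 'I_m -> int),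
    (forall p, p \in s -> p.2 = \sum_j e j *~ c p.2 j) /\
    (forall j, \sum_(p <- s) p.1 *~ c p.2 j = 0).
Proof.
move=> tfH s0.
pose x : {freeg (G * H)%type} := \sum_(p <- s) << p >>.
have pi_x : \pi_(tensor G H) x = \sum_(p <- s) tens p.1 p.2.
  rewrite /x; elim: s {x s0} => [|p s IHs]; first by rewrite !big_nil.
  by rewrite !big_cons -tensor_pi_add IHs; case: p.
have /tensor_rel_contract[L xL] : tensor_rel x.
  by rewrite -[x]subr0; apply/tensor_piP; rewrite pi_x s0.
pose M := L ++ map snd s.
have [m [e [fe Me]]] := zspan_free (fun i : 'I_(size M) => M`_i) tfH.
have eM h : h \in M -> zspan e h.
  by move=> /(nthP 0)[i iM <-]; apply/Me/(zspan_mem _ (Ordinal iM)).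
exists m, e, (zcoord e); split=> [p ps|j].
  by apply/zcoordE/eM; rewrite mem_cat map_f ?orbT.
rewrite -[RHS](xL m e fe _ j) => [|h hL]; last by apply: eM; rewrite mem_cat hL.
rewrite /x; elim: (s) => [|p r IHr].
  by rewrite !big_nil [RHS]fglift0.
by rewrite !big_cons IHr [RHS]fgliftD liftU scale1r.
Qed.

End TensorZero.

(** * Existence of states *)

Definition convex_cone (V : zmodType) (P : set V) : Prop :=
  P 0 /\ forall x y, P x -> P y -> P (x + y).

Lemma convex_coneMn (V : zmodType) (P : set V) (x : V) (n : nat) :
  convex_cone P -> P x -> P (x *+ n).
Proof.
by move=> [P0 PD] Px; elim: n => [|n IHn]; rewrite ?mulr0n// mulrS; apply: PD.
Qed.

Lemma convex_cone_sum (V : zmodType) (P : set V) (I : eqType) (r : seq I)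
    (F : I -> V) :
  convex_cone P -> (forall i, i \in r -> P (F i)) -> P (\sum_(i <- r) F i).
Proof.
by move=> [P0 PD] PF; rewrite big_seq; apply: big_ind.
Qed.

Definition proper_cone (V : zmodType) (u : V) (A : set V) : Prop :=
  convex_cone A /\ forall m, (0 < m)%N -> ~ A (- (u *+ m)).

Lemma exists_max_proper_cone (V : zmodType) (u : V) (P : set V) :
  proper_cone u P ->
  exists A, [/\ P `<=` A, proper_cone u A
    & forall B, proper_cone u B -> A `<=` B -> B `<=` A].
Proof.
move=> pP.
(* Zorn_bigcup also requires an upper bound of the empty chain. *)
pose good A := A = set0 \/ P `<=` A /\ proper_cone u A.
have [F Fgood Ftot|A [gA maxA]] := @Zorn_bigcup V good.
  have [[X FX X0]|F0] := pselect (exists2 X, F X & X !=set0); last first.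
    left; rewrite predeqE => x; split=> // -[X FX Xx].
    by apply: F0; exists X => //; exists x.
  right; have gX Y : F Y -> Y !=set0 -> P `<=` Y /\ proper_cone u Y.
    by move=> /Fgood[->[]|].
  have [PX [[XO _] _]] := gX _ FX X0.
  split; first by move=> x /PX Xx; exists X.
  split=> [|m m0 [Y FY Yum]].
    split; first by exists X.
    move=> x y [Y FY Yx] [Z FZ Zy].
    have [YZ|ZY] := Ftot _ _ FY FZ.
      exists Z => //; have [_ [[_ ZD] _]] := gX _ FZ (ex_intro _ _ Zy).
      by apply: ZD => //; apply: YZ.
    exists Y => //; have [_ [[_ YD] _]] := gX _ FY (ex_intro _ _ Yx).
    by apply: YD => //; apply: ZY.
  by have [_ [_ /(_ _ m0)/(_ Yum)]] := gX _ FY (ex_intro _ _ Yum).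
have {gA}[PA pA] : P `<=` A /\ proper_cone u A.
  case: gA => // A0; exfalso; apply: (maxA P); last by right; split=> [x|//].
  by rewrite A0; split=> // P0; case: pP => -[/P0].
exists A; split=> // B pB AB; apply: contrapT => nBA; apply: (maxA B).
  by split.
by right; split=> //; apply: subset_trans AB.
Qed.

Section MaximalCone.
Variables (R : realType) (V : zmodType) (u : V).

Variable A : set V.
Hypotheses (pA : proper_cone u A).
Hypothesis maxA : forall B, proper_cone u B -> A `<=` B -> B `<=` A.
Hypothesis A_unit : forall x, exists K : nat, A (u *+ K - x).

Let AD x y : A x -> A y -> A (x + y). Proof. exact: pA.1.2. Qed.

Let A_uz (z : int) : A (u *~ z) -> 0 <= z.
Proof. by case: z => // n; rewrite NegzE mulrNz => /(pA.2 n.+1 isT). Qed.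

(** The cone [B] generated by [A] and x strictly contains [A] unless x is in [A]. By maximality it
    then contains some - m u, and the coefficient of x used there is positive because [A] is
    proper. *)
Let A_dichotomy x :
  A x \/ exists n m, [/\ (0 < n)%N, (0 < m)%N & A (- (x *+ n) - u *+ m)].
Proof.
pose B := [set y | exists2 n, A (y - x *+ n) & True].
have [|/asboolPn] := pselect (A x); first by left.
move=> /asboolP nAx; right; apply: contrapT => nAxu; apply: nAx.
have AB : A `<=` B by move=> y Ay; exists 0%N; rewrite // mulr0n subr0.
apply: (@maxA B) => //; last first.
  by exists 1%N; rewrite // mulr1n subrr; apply: pA.1.1.
split; first split; first by apply/AB/pA.1.1.
- move=> y z [n Ay _] [k Az _]; exists (n + k)%N => //.
  suff -> : y + z - x *+ (n + k) = (y - x *+ n) + (z - x *+ k) by apply: AD.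
  by zmodule.
- move=> m m0 [[|n] Aum _].
    by apply: (pA.2 m m0); move: Aum; rewrite mulr0n subr0.
  by apply: nAxu; exists n.+1, m; split=> //; rewrite addrC.
Qed.

(** The fractions k / m with k u <= m x in the preorder of [A]. Their supremum is the value at x of
    the state under construction. *)
Let lower x : set R := [set r | exists m (k : int),
  [/\ (0 < m)%N, A (x *+ m - u *~ k) & r * m%:R = k%:~R]].

Let lower_neq0 x : lower x !=set0.
Proof.
have [K AK] := A_unit (- x).
exists (- K%:R), 1%N, (- K%:Z); split=> //; last by rewrite mulr1 mulrNz.
by rewrite (_ : _ - _ = u *+ K - - x)//; zmodule.
Qed.

Let lower_ub x : has_ubound (lower x).
Proof.
have [K AK] := A_unit x; exists K%:R => r [m [k [m0 Amk rmk]]].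
have : A (u *~ (K%:Z * m%:Z - k)).
  rewrite (_ : _ *~ _ = (u *+ K - x) *+ m + (x *+ m - u *~ k)); last by zmodule.
  by apply: AD => //; apply: convex_coneMn pA.1 _.
move=> /A_uz; rewrite subr_ge0 -(ler_int R) -rmk rmorphM /=.
by rewrite ler_pM2r// ltr0n.
Qed.

Let has_sup_lower x : has_sup (lower x).
Proof. by split; [exact: lower_neq0|exact: lower_ub]. Qed.

Let t x : R := sup (lower x).

Let lower_le x r : lower x r -> r <= t x.
Proof. exact: sup_upper_bound. Qed.

Let t_le x b : (forall r, lower x r -> r <= b) -> t x <= b.
Proof. by move=> rb; apply: ge_sup. Qed.

Let lowerD x y r s : lower x r -> lower y s -> lower (x + y) (r + s).
Proof.
move=> [m [k [m0 Axk rmk]]] [n [l [n0 Ayl snl]]].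
exists (m * n)%N, (k * n%:Z + l * m%:Z); split; first by rewrite muln_gt0 m0.
  rewrite (_ : _ - _ = (x *+ m - u *~ k) *+ n + (y *+ n - u *~ l) *+ m).
    by apply: AD; apply: convex_coneMn pA.1 _.
  by zmodule.
by rewrite rmorphD !rmorphM/= -rmk -snl; ring.
Qed.

Let tD_ge x y : t x + t y <= t (x + y).
Proof.
rewrite -lerBrDr; apply: t_le => r xr; rewrite lerBrDl -lerBrDr.
apply: t_le => s ys; rewrite lerBrDr addrC; apply: lower_le.
exact: lowerD.
Qed.

Let t0 : t 0 = 0.
Proof.
apply/eqP; rewrite eq_le; apply/andP; split.
  apply: t_le => r [m [k [m0 Ak rk]]].
  have /A_uz : A (u *~ - k) by move: Ak; rewrite mul0rn sub0r mulrNz.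
  rewrite oppr_ge0 -(ler_int R) -rk => rm0.
  by move: rm0; rewrite pmulr_lle0// ltr0n.
apply: lower_le; exists 1%N, 0; split=> //; last by rewrite mul0r.
by rewrite mul0rn mulr0z subr0; apply: pA.1.1.
Qed.

(** Superadditivity gives one inequality. If the other failed, take a rational q strictly between t
    x and - t (- x), and apply the dichotomy to x - q u with denominators cleared: either q is a
    lower fraction of x, or some number above - q is a lower fraction of - x. Both are
    impossible. *)
Let tN x : t (- x) = - t x.
Proof.
apply/eqP; rewrite eq_le; apply/andP; split.
  by rewrite -subr_ge0 -opprD oppr_ge0 -t0 -(subrr x) tD_ge.
rewrite leNgt; apply/negP; rewrite ltrNr => /rat_in_itvoo[q].
rewrite in_itv/= => /andP[txq qtx].
have := denq_gt0 q; case dq: (denq q) => [d|//] d0.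
have qd : ratr q * d%:R = (numq q)%:~R :> R.
  by rewrite /ratr dq divfK// pnatr_eq0 -lt0n.
have [Ax|[n [m [n0 m0 Ax]]]] := A_dichotomy (x *+ d - u *~ numq q).
  by move: txq; rewrite ltNge lower_le//; exists d, (numq q).
suff : m%:R / (d * n)%:R - ratr q <= t (- x).
  rewrite leNgt => /negP; apply; apply: (lt_trans (y := - ratr q)).
    by rewrite ltrNr.
  by rewrite ltrDr divr_gt0// ltr0n// muln_gt0 n0 andbT.
apply: lower_le; exists (d * n)%N, (m%:Z - numq q * n%:Z).
split; first by rewrite muln_gt0 n0 andbT.
  rewrite (_ : _ - _ = - ((x *+ d - u *~ numq q) *+ n) - u *+ m)//.
  by zmodule.
rewrite mulrBl divfK ?pnatr_eq0 -?lt0n ?muln_gt0 ?n0 ?andbT//.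
by rewrite natrM mulrA qd rmorphB rmorphM.
Qed.

Let tD : zmod_morphism t.
Proof.
move=> x y; apply/eqP; rewrite eq_le -{2}tN tD_ge andbT lerBrDr.
by rewrite -{2}(subrK y x) tD_ge.
Qed.

Let additive_t : {additive V -> R} :=
  HB.pack t (GRing.isZmodMorphism.Build V R t tD).

Let t1 : A u -> t u = 1.
Proof.
move=> Au; apply/eqP; rewrite eq_le; apply/andP; split.
  apply: t_le => r [m [k [m0 Ak rk]]].
  have /A_uz : A (u *~ (m%:Z - k)) by rewrite mulrzBr.
  by rewrite subr_ge0 -(ler_int R) -rk ger_pMl// ltr0n.
apply: lower_le; exists 1%N, 1; split; rewrite ?mulr1//.
by rewrite subrr; apply: pA.1.1.
Qed.

Let t_ge0 x : A x -> 0 <= t x.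
Proof.
move=> Ax; apply: lower_le; exists 1%N, 0; split=> //; last by rewrite mul0r.
by rewrite mulr0z subr0.
Qed.

Lemma max_cone_state : A u ->
  exists s : {additive V -> R}, s u = 1 /\ forall x, A x -> 0 <= s x.
Proof. by move=> Au; exists additive_t; split; [exact: t1|exact: t_ge0]. Qed.

End MaximalCone.

(** [P] is enlarged to a maximal proper cone, whose dichotomy makes the supremum formula
    additive. *)
Lemma exists_state (R : realType) (V : zmodType) (P : set V) (u : V) :
  convex_cone P -> (forall m, (0 < m)%N -> ~ P (- (u *+ m))) ->
  P u -> (forall x, exists K : nat, P (u *+ K - x)) ->
  exists s : {additive V -> R}, s u = 1 /\ forall x, P x -> 0 <= s x.
Proof.
move=> cP uP Pu P_unit.
have [A [PA pA maxA]] := exists_max_proper_cone (conj cP uP).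
have [||s [su sA]] := max_cone_state R pA maxA; last 2 first.
- exact: PA.
- by exists s; split=> // x /PA/sA.
- by move=> x; have [K /PA] := P_unit x; exists K.
Qed.

(** * Positivity through states, and approximate division *)

Lemma dimension_group_cone (V : zmodType) (P : set V) :
  dimension_group P -> convex_cone P.
Proof. by move=> [[P0 PD _] _ _ _]. Qed.

Lemma dimension_group_unperforated (V : zmodType) (P : set V) :
  dimension_group P -> unperforated P.
Proof. by case. Qed.

Lemma dimension_group_torsion_free (V : zmodType) (P : set V) :
  dimension_group P -> torsion_free V.
Proof.
move=> [[P0 _ Panti] _ Punp _] n x n0 xn0.
apply: Panti; apply: (Punp n) => //; first by rewrite xn0.
by rewrite mulNrn xn0 oppr0.
Qed.

Lemma order_unit_ub (V : zmodType) (P : set V) (u x : V) :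
  order_unit P u -> exists K : nat, (0 < K)%N /\ P (u *+ K - x).
Proof. by move=> [_ /(_ x)[K [K0 _ xK]]]; exists K. Qed.

Lemma order_unit_lb (V : zmodType) (P : set V) (u x : V) :
  order_unit P u -> exists K : nat, (0 < K)%N /\ P (u *+ K + x).
Proof.
by move=> [_ /(_ x)[K [K0 xK _]]]; exists K; split=> //; rewrite addrC -[u *+ K]opprK.
Qed.

Lemma trace_gt0 (R : realType) (V : zmodType) (P : set V) (u : V)
    (s : trace R P) : order_unit P u -> 0 < s u.
Proof.
move=> uP; rewrite lt_neqAle (trace_ge0 s uP.1) andbT eq_sym.
have [g] := trace_nonzero s; apply: contra_neq => su0.
have [K [_ /(trace_ge0 s)]] := order_unit_ub g uP.
have [L [_ /(trace_ge0 s)]] := order_unit_lb g uP.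
rewrite raddfD raddfB !raddfMn su0 !mul0rn /= add0r sub0r oppr_ge0 => g0 g1.
by apply/eqP; rewrite eq_le g1 g0.
Qed.

(* Otherwise y could be made nonpositive by a state: enlarge P by -y. *)
Lemma state_gt0_pos (R : realType) (V : zmodType) (P : set V) (u y : V) :
  convex_cone P -> unperforated P -> order_unit P u ->
  (forall s : trace R P, s u = 1 -> 0 < s y) -> P y.
Proof.
move=> cP Punp uP y_gt0; apply: contrapT => nPy.
have [P0 PD] := cP.
pose Q := [set x | exists m n, (0 < m)%N /\ P (x *+ m + y *+ n)].
have PQ : P `<=` Q by move=> x Px; exists 1%N, 0%N; rewrite mulr0n addr0.
have cQ : convex_cone Q.
  split; first exact: PQ.
  move=> x z [m [n [m0 xy]]] [k [l [k0 zy]]].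
  exists (m * k)%N, (n * k + l * m)%N; split; first by rewrite muln_gt0 m0.
  rewrite (_ : _ + _ = (x *+ m + y *+ n) *+ k + (z *+ k + y *+ l) *+ m).
    by apply: PD; apply: convex_coneMn.
  by zmodule.
have [k k0 [m [n [m0 Puy]]]||x|s [su sQ]] :=
  @exists_state R V Q u cQ.
(* Properness of [Q]: if - k u is in [Q], then n y >= k m u. For n > 0 unperforation gives y >= 0.
   For n = 0 the element - k m u is itself positive, which forces y >= 0 as well because y >= - K
   u. *)
- have [n0|n0] := posnP n; last first.
    apply/nPy/(Punp n) => //.
    rewrite (_ : y *+ n = - (u *+ k) *+ m + y *+ n + u *+ k *+ m); last by zmodule.
    by apply: PD => //; do 2!apply: convex_coneMn => //; apply: uP.1.
  have [K [_ yK]] := order_unit_lb y uP.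
  apply/nPy/(Punp (k * m)%N); first by rewrite muln_gt0 k0.
  rewrite (_ : y *+ _ =
    (u *+ K + y) *+ (k * m) + (- (u *+ k) *+ m + y *+ n) *+ K).
    by apply: PD; apply: convex_coneMn.
  by rewrite n0; zmodule.
- exact/PQ/uP.1.
- by have [K [_ xK]] := order_unit_ub x uP; exists K; apply: PQ.
have s_neq0 : exists g, s g != 0 by exists u; rewrite su oner_neq0.
have := y_gt0 (Trace s_neq0 (fun g Pg => sQ g (PQ g Pg))) su.
rewrite /= ltNge => /negP; apply; rewrite -oppr_ge0 -raddfN; apply: sQ.
by exists 1%N, 1%N; split=> //; rewrite addNr.
Qed.

(** The affine function of g divided by N is approximated uniformly by that of some h; a uniform
    bound on states becomes an order bound by [state_gt0_pos]. *)
Lemma approximate_division (R : realType) (V : zmodType) (P : set V) (u : V) :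
  convex_cone P -> unperforated P -> order_unit P u ->
  approximately_divisible R P u ->
  forall (g w : V) (N L : nat), (0 < N)%N -> (0 < L)%N -> order_unit P w ->
  exists h, P (w + (g - h *+ N) *+ L) /\ P (w - (g - h *+ N) *+ L).
Proof.
move=> cP Punp uP uad g w N L N0 L0 wP.
have [K [K0 uK]] := order_unit_ub u wP.
have fAff : Aff (@state_space R V P u) (fun t => t g / N%:R).
  split=> [|s t a _ _ _]; last by rewrite !mulrA mulrDl.
  apply: continuous_subspaceT => t.
  apply: (@continuousM _ _ (fun t : {ptws V -> R} => t g) (cst N%:R^-1)).
    exact: (@proj_continuous V (fun=> R) g t).
  exact: cst_continuous.
(* From u <= K w every state satisfies s w >= 1 / K. An error below 1 / (K N L) on g / N is one
   below 1 / K on L (g - N h). *)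
pose e : R := ((K * N * L)%:R)^-1.
have e0 : 0 < e by rewrite invr_gt0 ltr0n !muln_gt0 K0 N0.
have [h gh] := uad _ fAff e e0.
exists h.
suff s_small (s : trace R P) : s u = 1 -> `|s ((g - h *+ N) *+ L)| < s w.
  by split; apply: (state_gt0_pos cP Punp uP) => s /s_small;
    rewrite ltr_norml => /andP[]; rewrite ?raddfB ?raddfD; lra.
move=> su; have := gh (s : V -> R) (ex_intro _ s (conj su erefl)).
rewrite /affine_rep raddfMn raddfB raddfMn.
have : 0 <= s (w *+ K - u) by exact: trace_ge0.
rewrite raddfB raddfMn su subr_ge0.
have KR : 0 < K%:R :> R by rewrite ltr0n.
have NR : 0 < N%:R :> R by rewrite ltr0n.
have LR : 0 < L%:R :> R by rewrite ltr0n.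
rewrite -[s w *+ K]mulr_natr -ler_pdivrMr// => swK.
have -> : s g / N%:R - s h = (s g - s h *+ N) / N%:R.
  by rewrite -[s h *+ N]mulr_natr; field; rewrite gt_eqF.
rewrite normrM [`|N%:R^-1|]gtr0_norm ?invr_gt0// ltr_pdivrMr// => ghN.
rewrite normrMn -mulr_natr; apply: lt_le_trans swK.
rewrite -ltr_pdivlMr//; apply: (lt_le_trans ghN).
rewrite le_eqVlt; apply/orP; left; apply/eqP; rewrite /e !natrM; field.
by rewrite !gt_eqF.
Qed.

Lemma small_order_unit (R : realType) (V : zmodType) (P : set V) (u : V) :
  convex_cone P -> unperforated P -> order_unit P u ->
  approximately_divisible R P u ->
  forall (w : V) (C : nat), order_unit P w ->
  exists2 h, order_unit P h & P (w - h *+ C).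
Proof.
move=> cP Punp uP uad w C wP.
(* This h approximates w / (2 (C + 1)) and satisfies w <= 4 (C + 1) h <= 3 w. The first inequality
   makes h an order unit, the second gives C h <= w. *)
have [h [hl hr]] := approximate_division cP Punp uP uad w (N := C.+1 * 2) (L := 2)
  isT isT wP.
have P_h4 : P (h *+ (C.+1 * 4) - w).
  rewrite (_ : _ - _ = w - (w - h *+ (C.+1 * 2)) *+ 2)//; zmodule.
have [P0 PD] := cP.
have Ph : P h.
  apply: (Punp (C.+1 * 4)%N) => //.
  by rewrite -(subrK w (h *+ _)); apply: PD => //; apply: wP.1.
exists h; first split=> // x.
  have [_ /(_ x)[K [K0 Kl Kr]]] := wP.
  exists (C.+1 * 4 * K)%N; split; first by rewrite muln_gt0.
    rewrite /cone_le (_ : _ - _ =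
      (x - - (w *+ K)) + (h *+ (C.+1 * 4) - w) *+ K); last by zmodule.
    by apply: PD => //; apply: convex_coneMn.
  rewrite /cone_le (_ : _ - _ =
    (w *+ K - x) + (h *+ (C.+1 * 4) - w) *+ K); last by zmodule.
  by apply: PD => //; apply: convex_coneMn.
apply: (Punp 4%N) => //.
rewrite (_ : _ *+ _ = (w + (w - h *+ (C.+1 * 2)) *+ 2) + w + h *+ 4); last by zmodule.
by apply: (PD _ _ _ (convex_coneMn 4 cP Ph)); apply: (PD _ _ hl wP.1).
Qed.

(** * The positive cone of a tensor product *)

Section Tens.
Variables G H : zmodType.

Lemma tens_zmod_morphismr (g : G) : zmod_morphism (@tens G H g).
Proof. by move=> x y; apply: (addIr (tens g y)); rewrite subrK -tensDr subrK. Qed.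

Lemma tens_zmod_morphisml (h : H) : zmod_morphism ((@tens G H)^~ h).
Proof. by move=> x y; apply: (addIr (tens y h)); rewrite subrK -tensDl subrK. Qed.

Let tensr (g : G) : {additive H -> tensor G H} := HB.pack (@tens G H g)
  (GRing.isZmodMorphism.Build _ _ _ (tens_zmod_morphismr g)).

Let tensl (h : H) : {additive G -> tensor G H} := HB.pack ((@tens G H)^~ h)
  (GRing.isZmodMorphism.Build _ _ _ (tens_zmod_morphisml h)).

Lemma tens0r (g : G) : tens g (0 : H) = 0.
Proof. exact: (raddf0 (tensr g)). Qed.
Lemma tens0l (h : H) : tens (0 : G) h = 0.
Proof. exact: (raddf0 (tensl h)). Qed.
Lemma tensNr (g : G) (h : H) : tens g (- h) = - tens g h.
Proof. exact: (raddfN (tensr g)). Qed.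
Lemma tensNl (g : G) (h : H) : tens (- g) h = - tens g h.
Proof. exact: (raddfN (tensl h)). Qed.
Lemma tensMnr (g : G) (h : H) (n : nat) : tens g (h *+ n) = tens g h *+ n.
Proof. exact: (raddfMn (tensr g)). Qed.
Lemma tensMnl (g : G) (h : H) (n : nat) : tens (g *+ n) h = tens g h *+ n.
Proof. exact: (raddfMn (tensl h)). Qed.
Lemma tensMzr (g : G) (h : H) (z : int) : tens g (h *~ z) = tens g h *~ z.
Proof. exact: (raddfMz (tensr g)). Qed.
Lemma tensMzl (g : G) (h : H) (z : int) : tens (g *~ z) h = tens g h *~ z.
Proof. exact: (raddfMz (tensl h)). Qed.
Lemma tens_sumr (I : Type) (r : seq I) (g : G) (F : I -> H) :
  tens g (\sum_(i <- r) F i) = \sum_(i <- r) tens g (F i).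
Proof. exact: (raddf_sum (tensr g)). Qed.
Lemma tens_suml (I : Type) (r : seq I) (F : I -> G) (h : H) :
  tens (\sum_(i <- r) F i) h = \sum_(i <- r) tens (F i) h.
Proof. exact: (raddf_sum (tensl h)). Qed.

Definition tensE := (tensDl, tensDr, tensNl, tensNr, tensMnl, tensMnr, tensMzl,
  tensMzr, tens0l, tens0r).

(** The integer coefficients of a formal sum are absorbed into the left factors, so unsigned sums of
    pure tensors exhaust the tensor product. *)
Lemma tensor_ind (T : tensor G H -> Prop) :
  (forall g h, T (tens g h)) -> (forall x y, T x -> T y -> T (x + y)) ->
  forall x, T x.
Proof.
move=> Ttens TD x; elim/quotW: x => D; rewrite -(freeg_sumE D).
have T0 : T 0 by rewrite -(tens0l 0).
elim: (dom D) => [|p s IHs]; first by rewrite big_nil.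
rewrite big_cons -tensor_pi_add; apply: TD => //.
have -> : \pi_(tensor G H) << coeff p D *g p >> = tens (p.1 *~ coeff p D) p.2.
  rewrite tensMzl /tens; case: p => g h /=.
  pose pi : {additive {freeg (G * H)%type} -> tensor G H} :=
    HB.pack (\pi_(tensor G H))
    (GRing.isZmodMorphism.Build _ _ _ (@tensor_pi_zmod_morphism G H)).
  by rewrite -[RHS](raddfMz pi) freegU_mulz intz.
exact: Ttens.
Qed.

Lemma tensor_sum_tens (x : tensor G H) :
  exists s : seq (G * H), x = \sum_(p <- s) tens p.1 p.2.
Proof.
elim/tensor_ind: x => [g h|x y [s ->] [r ->]].
  by exists [:: (g, h)]; rewrite big_seq1.
by exists (s ++ r); rewrite big_cat.
Qed.

Variables (P : set G) (Q : set H).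

Lemma tensor_cone_tens (g : G) (h : H) :
  P g -> Q h -> tensor_cone P Q (tens g h).
Proof.
move=> Pg Qh; exists [:: (g, h)]; rewrite big_seq1; split=> // p.
by rewrite inE => /eqP->.
Qed.

Lemma tensor_cone_convex : convex_cone (tensor_cone P Q).
Proof.
split; first by exists nil; rewrite big_nil.
move=> _ _ [s [sP ->]] [r [rP ->]]; exists (s ++ r); rewrite big_cat; split=> // p.
by rewrite mem_cat => /orP[/sP|/rP].
Qed.

End Tens.

Lemma order_unit_bound (V : zmodType) (P : set V) (u : V) :
  convex_cone P -> order_unit P u -> forall x, exists K : nat,
    P (u *+ K - x) /\ P (u *+ K + x).
Proof.
move=> cP uP x; have [P0 PD] := cP.
have [K [_ xK]] := order_unit_ub x uP.
have [L [_ xL]] := order_unit_lb x uP.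
exists (K + L)%N; split.
  rewrite (_ : _ - _ = u *+ K - x + u *+ L); last by zmodule.
  by apply: PD => //; apply: convex_coneMn => //; apply: uP.1.
rewrite (_ : _ + _ = u *+ L + x + u *+ K); last by zmodule.
by apply: PD => //; apply: convex_coneMn => //; apply: uP.1.
Qed.

Lemma convex_cone_mulz (V : zmodType) (P : set V) (w x : V) (z : int) :
  convex_cone P -> P (w + x) -> P (w - x) -> P (w *+ `|z|%N + x *~ z).
Proof.
move=> cP wx wNx; case: z => n; rewrite /absz.
  by rewrite -pmulrn -mulrnDl; apply: convex_coneMn.
by rewrite NegzE mulrNz -mulNrz -pmulrn -mulrnDl; apply: convex_coneMn.
Qed.

(** Expanding (w + z) (x) (K v + h) + K (w - z) (x) v + w (x) (K v - h), the mixed terms cancel and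
    w (x) v occurs 3 K times. *)
Lemma tens_lower_bound (G H : zmodType) (P : set G) (Q : set H) (w z : G)
    (v h : H) (K : nat) :
  P w -> Q v -> P (w + z) -> P (w - z) -> Q (v *+ K - h) -> Q (v *+ K + h) ->
  tensor_cone P Q (tens z h + tens w v *+ (3 * K)).
Proof.
move=> Pw Qv wz wNz vNh vh; have [_ TD] := tensor_cone_convex P Q.
rewrite (_ : _ + _ = tens (w + z) (v *+ K + h) +
  (tens (w - z) v *+ K + tens w (v *+ K - h))); last by rewrite !tensE; zmodule.
apply: (TD); first exact: tensor_cone_tens.
apply: (TD); last exact: tensor_cone_tens.
by apply: convex_coneMn; [exact: tensor_cone_convex|exact: tensor_cone_tens].
Qed.

Lemma tensor_cone_almost_unperforated (R : realType) (G H : zmodType)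
    (P : set G) (Q : set H) (u : G) (v : H) :
  convex_cone P -> unperforated P -> order_unit P u ->
  approximately_divisible R P u ->
  convex_cone Q -> torsion_free H -> order_unit Q v ->
  forall (n : nat) (x : tensor G H), (0 < n)%N ->
    tensor_cone P Q (x *+ n - tens u v) -> tensor_cone P Q x.
Proof.
move=> cP Punp uP uad cQ tfH vQ n x n0 xn.
have cT := tensor_cone_convex P Q; have [T0 TD] := cT; have [P0 PD] := cP.
(* As n u1 <= u, the element y = x - u1 (x) v still has n y >= 0, and u1 (x) v is kept in reserve to
   pay for the errors made in dividing by n. *)
have [u1 u1P uu1] := small_order_unit cP Punp uP uad n uP.
pose y := x - tens u1 v.
have [ef [efPQ yef]] : tensor_cone P Q (y *+ n).
  rewrite (_ : _ *+ _ = (x *+ n - tens u v) + tens (u - u1 *+ n) v).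
    by apply: TD => //; apply: tensor_cone_tens => //; apply: vQ.1.
  by rewrite /y !tensE; zmodule.
have [sb ysb] := tensor_sum_tens y.
pose r := [seq (p.1 *+ n, p.2) | p <- sb] ++ [seq (- p.1, p.2) | p <- ef].
have [m [e [c [r2 r1]]]] : exists m (e : 'I_m -> H) (c : H -> 'I_m -> int),
    (forall p, p \in r -> p.2 = \sum_j e j *~ c p.2 j) /\
    (forall j, \sum_(p <- r) p.1 *~ c p.2 j = 0).
  apply: (tens_sum_eq0 tfH); rewrite big_cat !big_map /=.
  under eq_bigr do rewrite tensMnl.
  under [X in _ + X]eq_bigr do rewrite tensNl.
  by rewrite sumrMnl sumrN -ysb -yef subrr.
have [K KQ] := choice (order_unit_bound cQ vQ).
(* [C] counts the copies of u2 (x) v spent below: 3 K(e_j) to make z_j (x) e_j positive, and K(p.2)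
   for the shift of [a p.1] by [u2]. [D] exceeds the total size of the coefficients, so that the
   errors collected in each z_j stay below [u2]. *)
pose C := (\sum_j 3 * K (e j) + \sum_(p <- ef) K p.2)%N.
pose D := (\sum_j \sum_(p <- ef) `|c p.2 j|).+1%N.
have [u2 u2P uu2] := small_order_unit cP Punp uP uad C u1P.
have [a aP] := choice (fun g =>
  approximate_division cP Punp uP uad g n0 (isT : 0 < D)%N u2P).
(* [a g] approximates g / n and may fail to be positive; the shift by [u2] repairs this. *)
have a_ge g : P g -> P (a g + u2).
  move=> Pg; apply: (Punp (D * n)%N); first by rewrite muln_gt0.
  have DnE : (D * n = (D * n).-1.+1)%N by rewrite prednK// muln_gt0.
  rewrite (_ : _ *+ _ =
    g *+ D + (u2 - (g - a g *+ n) *+ D) + u2 *+ (D * n).-1).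
    apply: (PD); last exact: (convex_coneMn _ cP u2P.1).
    by apply: (PD); [exact: convex_coneMn|exact: (aP g).2].
  by rewrite mulrnDl {2}DnE; zmodule.
pose z j := \sum_(p <- sb) p.1 *~ c p.2 j - \sum_(p <- ef) a p.1 *~ c p.2 j.
(* The j-th coordinate of n y = sum of [ef] turns n z_j into a combination of division errors
   only. *)
have zn j : z j *+ n = \sum_(p <- ef) (p.1 - a p.1 *+ n) *~ c p.2 j.
  have := r1 j; rewrite big_cat !big_map /=.
  have swap (g : G) (k : int) : g *+ n *~ k = g *~ k *+ n by zmodule.
  under eq_bigr do rewrite swap.
  under [X in _ + X]eq_bigr do rewrite mulNrz.
  rewrite sumrMnl sumrN => /eqP; rewrite subr_eq0 => /eqP r1j.
  rewrite mulrnBl r1j -sumrMnl -sumrB; apply: eq_bigr => p _; zmodule.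
have z_bound_sign j (b : int) : `|b|%N = 1%N -> P (u2 + z j *~ b).
  move=> b1; apply: (Punp (D * n)%N); first by rewrite muln_gt0.
  have cD : (\sum_(p <- ef) `|c p.2 j| <= D * n)%N.
    by apply: leq_trans (leq_pmulr _ n0); rewrite leqW// (bigD1 j)//= leq_addr.
  rewrite (_ : _ *+ _ = \sum_(p <- ef)
    (u2 *+ `|c p.2 j * b| + ((p.1 - a p.1 *+ n) *+ D) *~ (c p.2 j * b))
    + u2 *+ (D * n - \sum_(p <- ef) `|c p.2 j|)).
    apply: (PD); last exact: (convex_coneMn _ cP u2P.1).
    apply: convex_cone_sum => // p _.
    by apply: convex_cone_mulz => //; case: (aP p.1).
  rewrite big_split /=; under eq_bigr do rewrite abszM b1 muln1.
  rewrite sumrMnr addrAC -mulrnDr subnKC// mulrnDl; congr (_ + _).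
  transitivity (z j *+ n *~ (D%:Z * b)); first by zmodule.
  by rewrite zn mulrz_suml; apply: eq_bigr => p _; zmodule.
have z_bound j : P (u2 + z j) /\ P (u2 - z j).
  by split; [have := @z_bound_sign j 1 erefl|have := @z_bound_sign j (-1) erefl];
    rewrite ?mulrNz mulr1z.
have sum_e (s : seq (G * H)) (f : G -> G) :
    (forall p, p \in s -> p.2 = \sum_j e j *~ c p.2 j) ->
    \sum_(p <- s) tens (f p.1) p.2 =
    \sum_j tens (\sum_(p <- s) f p.1 *~ c p.2 j) (e j).
  move=> sE; under [RHS]eq_bigr do rewrite tens_suml.
  rewrite exchange_big big_seq [RHS]big_seq; apply: eq_bigr => p /sE {1}->.
  by rewrite tens_sumr; apply: eq_bigr => j _; rewrite tensMzl tensMzr.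
have yE : y = \sum_(p <- ef) tens (a p.1) p.2 + \sum_j tens (z j) (e j).
  rewrite ysb (sum_e sb id) => [|p psb]; last first.
    by apply: (r2 (p.1 *+ n, p.2)); rewrite mem_cat map_f.
  rewrite (sum_e ef a) => [|p pef]; last first.
    by apply: (r2 (- p.1, p.2)); rewrite mem_cat map_f ?orbT.
  rewrite -big_split; apply: eq_bigr => j _.
  by rewrite /= -tensDl /z addrC subrK.
(* Every summand is positive; the last one is what remains of the reserve, since C u2 <= u1. *)
rewrite (_ : x = \sum_(p <- ef) tens (a p.1 + u2) p.2
  + \sum_(p <- ef) tens u2 (v *+ K p.2 - p.2)
  + \sum_j (tens (z j) (e j) + tens u2 v *+ (3 * K (e j)))
  + tens (u1 - u2 *+ C) v).
  apply: (TD); last by apply: tensor_cone_tens => //; apply: vQ.1.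
  apply: (TD).
    apply: (TD); apply: convex_cone_sum => // p /efPQ[Pp Qp];
      apply: tensor_cone_tens => //; first exact: a_ge.
      exact: u2P.1.
    exact: (KQ _).1.
  apply: convex_cone_sum => // j _; have [? ?] := z_bound j.
  have [? ?] := KQ (e j).
  by apply: tens_lower_bound => //; [exact: u2P.1|exact: vQ.1].
rewrite -[x](subrK (tens u1 v)) -/y yE.
have -> : \sum_(p <- ef) tens (a p.1 + u2) p.2 =
    \sum_(p <- ef) tens (a p.1) p.2 + \sum_(p <- ef) tens u2 p.2.
  by rewrite -big_split; apply: eq_bigr => p _; rewrite tensDl.
have -> : \sum_(p <- ef) tens u2 (v *+ K p.2 - p.2) =
    tens u2 v *+ (\sum_(p <- ef) K p.2)%N - \sum_(p <- ef) tens u2 p.2.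
  by rewrite -sumrMnr -sumrB; apply: eq_bigr => p _; rewrite !tensE.
have -> : \sum_j (tens (z j) (e j) + tens u2 v *+ (3 * K (e j))) =
    \sum_j tens (z j) (e j) + tens u2 v *+ (\sum_j 3 * K (e j))%N.
  by rewrite -sumrMnr -big_split.
by rewrite !tensE mulrnDr; zmodule.
Qed.

(** * Order-bounded elements and the divisible hull *)

Section OrderBounded.
Variables (R : realType) (V : zmodType) (P : set V) (w : V).
Hypothesis cP : convex_cone P.

(* The rational form of [- e w <= x <= e w]. *)
Definition order_bounded (x : V) (e : R) : Prop := exists m k : nat,
  [/\ (0 < m)%N, k%:R <= e * m%:R, P (w *+ k - x *+ m) & P (w *+ k + x *+ m)].

Let P0 : P 0. Proof. exact: cP.1. Qed.
Let PD x y : P x -> P y -> P (x + y). Proof. exact: cP.2. Qed.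

Lemma order_boundedW (x : V) (e f : R) :
  e <= f -> order_bounded x e -> order_bounded x f.
Proof.
move=> ef [m [k [m0 ke xk kx]]]; exists m, k; split=> //.
by apply: le_trans ke _; rewrite ler_wpM2r.
Qed.

Lemma order_boundedD (x y : V) (e f : R) :
  order_bounded x e -> order_bounded y f -> order_bounded (x + y) (e + f).
Proof.
move=> [m [k [m0 ke xk kx]]] [n [l [n0 lf yl ly]]].
exists (m * n)%N, (k * n + l * m)%N; split; first by rewrite muln_gt0 m0.
- rewrite natrD !natrM mulrDl mulrA [m%:R * _]mulrC mulrA.
  by apply: lerD; rewrite ler_wpM2r.
- rewrite (_ : _ - _ = (w *+ k - x *+ m) *+ n + (w *+ l - y *+ n) *+ m).
    by apply: PD; apply: convex_coneMn.
  by zmodule.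
- rewrite (_ : _ + _ = (w *+ k + x *+ m) *+ n + (w *+ l + y *+ n) *+ m).
    by apply: PD; apply: convex_coneMn.
  by zmodule.
Qed.

Lemma order_boundedMz (x : V) (e : R) (z : int) :
  order_bounded x e -> order_bounded (x *~ z) (`|z|%N%:R * e).
Proof.
move=> [m [k [m0 ke xk kx]]]; exists m, (k * `|z|)%N; split=> //.
- by rewrite natrM mulrC -mulrA ler_wpM2l.
- rewrite (_ : _ - _ = w *+ k *+ `|z| + x *+ m *~ - z); last by zmodule.
  by rewrite -abszN; apply: convex_cone_mulz.
- rewrite (_ : _ + _ = w *+ k *+ `|z| + x *+ m *~ z); last by zmodule.
  exact: convex_cone_mulz.
Qed.

Lemma order_boundedMn (x : V) (e : R) (n : nat) :
  order_bounded x e -> order_bounded (x *+ n) (n%:R * e).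
Proof. by move/(@order_boundedMz _ _ n%:Z). Qed.

Lemma order_boundedN (x : V) (e : R) :
  order_bounded x e -> order_bounded (- x) e.
Proof. by move=> /(@order_boundedMz _ _ (-1)); rewrite mulrNz mulr1z mul1r. Qed.

(** The multiplier [m] in [order_bounded] absorbs n. Bounds can thus be divided in the tensor
    product, where only a weak form of unperforation has been established. *)
Lemma order_bounded_divn (x : V) (e : R) (n : nat) :
  (0 < n)%N -> order_bounded (x *+ n) (n%:R * e) -> order_bounded x e.
Proof.
move=> n0 [m [k [m0 ke xk kx]]]; exists (n * m)%N, k.
by rewrite muln_gt0 n0 m0 natrM mulrA [e * _]mulrC ke !mulrnA.
Qed.

Lemma order_bounded_mulz (z : int) : P w -> order_bounded (w *~ z) `|z|%N%:R.
Proof.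
move=> Pw; rewrite -[X in order_bounded _ X]mulr1; apply: order_boundedMz.
by exists 1%N, 1%N; rewrite mulr1 subrr; split=> //; apply: PD.
Qed.

Lemma order_bounded_order_unit (x : V) : order_unit P w ->
  exists k : nat, order_bounded x k%:R.
Proof.
move=> wP; have [k [xk kx]] := order_unit_bound cP wP x.
by exists k, 1%N, k; rewrite mulr1 mulr1n.
Qed.

Lemma order_bounded_trace (s : trace R P) (x : V) (e : R) :
  P w -> order_bounded x e -> `|s x| <= e * s w.
Proof.
move=> Pw [m [k [m0 ke /(trace_ge0 s) xk /(trace_ge0 s) kx]]].
have mR : 0 < m%:R :> R by rewrite ltr0n.
rewrite -(ler_pM2r mR) -{1}[m%:R]gtr0_norm// -normrM.
apply: (@le_trans _ _ (k%:R * s w)).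
  by move: xk kx; rewrite raddfB raddfD !raddfMn /= !mulr_natr mulr_natl ler_norml; lra.
by rewrite mulrAC ler_wpM2r// trace_ge0.
Qed.

End OrderBounded.

(** The factor 2 in the witnesses comes from (k u - m g) (x) (l v + n h) + (k u + m g) (x) (l v - n
    h) = 2 (k l u (x) v - m n g (x) h) and its analogue with h replaced by - h. *)
Lemma order_bounded_tens (R : realType) (G H : zmodType) (P : set G)
    (Q : set H) (u g : G) (v h : H) (e f : R) :
  order_bounded P u g e -> order_bounded Q v h f ->
  order_bounded (tensor_cone P Q) (tens u v) (tens g h) (e * f).
Proof.
move=> [m [k [m0 ke gk kg]]] [n [l [n0 lf hl lh]]].
have [_ TD] := tensor_cone_convex P Q.
exists (m * n * 2)%N, (k * l * 2)%N; split; first by rewrite !muln_gt0 m0 n0.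
- rewrite !natrM (_ : e * f * _ = e * m%:R * (f * n%:R) * 2); last by ring.
  by rewrite ler_wpM2r// ler_pM.
- rewrite (_ : _ - _ = tens (u *+ k - g *+ m) (v *+ l + h *+ n)
    + tens (u *+ k + g *+ m) (v *+ l - h *+ n)).
    by apply: (TD); apply: tensor_cone_tens.
  by rewrite !tensE; zmodule.
- rewrite (_ : _ + _ = tens (u *+ k + g *+ m) (v *+ l + h *+ n)
    + tens (u *+ k - g *+ m) (v *+ l - h *+ n)).
    by apply: (TD); apply: tensor_cone_tens.
  by rewrite !tensE; zmodule.
Qed.

Section DivisibleHull.
Variables (V : zmodType) (P : set V).
Hypothesis cP : convex_cone P.
Let T := tensor_cone P rat_cone.

Lemma torsion_free_rat : torsion_free rat.
Proof.
by move=> n x n0 /eqP; rewrite mulrn_eq0 => /orP[/eqP n0'|/eqP//]; rewrite n0' in n0.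
Qed.

(** For a one-term sum the vanishing criterion gives x c_j = 0 for all j, while 1 = sum_j c_j e_j
    forces some c_j to be nonzero. *)
Lemma tens_rat1_inj (x : V) : torsion_free V -> tens x (1 : rat) = 0 -> x = 0.
Proof.
move=> tfV x0.
have [||m [e [c [c1 xc]]]] := @tens_sum_eq0 V rat [:: (x, 1)].
- exact: torsion_free_rat.
- by rewrite big_seq1.
have {}c1 : 1 = \sum_j e j *~ c 1 j := c1 (x, 1) (mem_head _ _).
have [[j cj]|nc] := pselect (exists j, c 1 j != 0).
  by apply: (torsion_freez tfV cj); have := xc j; rewrite big_seq1.
move: (oner_neq0 rat); rewrite {1}c1 big1 ?eqxx// => j _.
have [->|cj] := eqVneq (c 1 j) 0; first by rewrite mulr0z.
by case: nc; exists j.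
Qed.

Lemma tensor_cone_rat (x : tensor V rat) : T x ->
  exists n a, [/\ (0 < n)%N, P a & x *+ n = tens a 1].
Proof.
have [P0 PD] := cP.
move=> [s [sP ->]]; elim: s sP => [|[g q] s IHs] sP.
  by exists 1%N, 0; rewrite big_nil mul0rn tens0l.
have [|n [a [n0 Pa na]]] := IHs; first by move=> p ps; apply: sP; rewrite inE ps orbT.
have [/= Pg q0] := sP _ (mem_head _ _).
have := denq_gt0 q; case dq: (denq q) => [d|//]; rewrite ltz_nat => d0.
have : 0 <= numq q by rewrite numq_ge0.
case nq: (numq q) => [k|//] _.
have qd : q *+ d = k%:R.
  have := divq_num_den q; rewrite nq dq -!pmulrn => {1}<-.
  by rewrite -[_ / _ *+ d]mulr_natr divfK// pnatr_eq0 -lt0n.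
exists (d * n)%N, (g *+ (k * n) + a *+ d); split.
- by rewrite muln_gt0 d0.
- by apply: PD; apply: convex_coneMn.
rewrite big_cons /=; move: (\sum_(p <- s) _) na => y na.
rewrite (_ : _ *+ _ = tens g (q *+ d) *+ n + y *+ n *+ d); last first.
  by rewrite tensMnr; zmodule.
by rewrite qd na !tensE; zmodule.
Qed.

Lemma order_unit_tens_rat (u : V) (M : nat) : (0 < M)%N -> order_unit P u ->
  order_unit T (tens u M%:R^-1).
Proof.
move=> M0 uP; have [_ TD] := tensor_cone_convex P rat_cone.
have Tb : T (tens u M%:R^-1).
  by apply: tensor_cone_tens; [exact: uP.1|rewrite /rat_cone /= invr_ge0].
split=> // x; suff [K [xK Kx]] : exists K,
    T (tens u M%:R^-1 *+ K - x) /\ T (tens u M%:R^-1 *+ K + x).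
  exists K.+1; split; rewrite // /cone_le ?opprK.
    by rewrite addrC mulrS -addrA; apply: TD.
  by rewrite mulrS -addrA; apply: TD.
(* If - J u <= g <= J u and 0 <= q <= k, then g (x) q is bounded by J u (x) k, that is, by J k M
   copies of u (x) 1/M. *)
have T_pos g (q : rat) : 0 <= q -> exists K,
    T (tens u M%:R^-1 *+ K - tens g q) /\ T (tens u M%:R^-1 *+ K + tens g q).
  move=> q0; have [J [gJ Jg]] := order_unit_bound cP uP g.
  pose k := Num.bound q.
  have bE : tens u (M%:R^-1 : rat) *+ (J * k * M) = tens (u *+ J) k%:R.
    rewrite mulnC mulrnA -tensMnr -[_^-1 *+ M]mulr_natr mulVf; last first.
      by rewrite pnatr_eq0 -lt0n.
    by rewrite tensMnl tensMnr; zmodule.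
  have Tkq : T (tens (u *+ J) (k%:R - q)).
    apply: tensor_cone_tens; first by apply: convex_coneMn => //; exact: uP.1.
    by rewrite /rat_cone /= subr_ge0 ltW// archi_boundP.
  exists (J * k * M)%N; rewrite bE; split.
    rewrite (_ : _ - _ = tens (u *+ J - g) q + tens (u *+ J) (k%:R - q)).
      by apply: (TD) => //; apply: tensor_cone_tens.
    by rewrite !(tensDl, tensDr, tensNl, tensNr); zmodule.
  rewrite (_ : _ + _ = tens (u *+ J + g) q + tens (u *+ J) (k%:R - q)).
    by apply: (TD) => //; apply: tensor_cone_tens.
  by rewrite !(tensDl, tensDr, tensNl, tensNr); zmodule.
elim/tensor_ind: x => [g q|x y [K [xK Kx]] [L [yL Ly]]].
  have [/T_pos//|/ltW q0] := leP 0 q.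
  have -> : tens g q = tens (- g) (- q) by rewrite tensNl tensNr opprK.
  by apply: T_pos; rewrite oppr_ge0.
exists (K + L)%N; split.
  by rewrite mulrnDr opprD addrACA; apply: TD.
by rewrite mulrnDr addrACA; apply: TD.
Qed.

(** Goodness is applied in the divisible hull to the order unit u (x) 1/M: the remainder of sigma g
    modulo sigma u / M is the trace of some a with 0 <= a <= u (x) 1/M. Then g - (f / M) u - a lies
    in the kernel, and denominators are cleared. *)
Lemma trace_decomposition (R : realType) (sigma : trace R P) (u : V) :
  torsion_free V -> order_unit P u ->
  order_unit_good (tensor_trace sigma (rat_trace R)) ->
  forall (g : V) (M : nat), (0 < M)%N ->
  exists (N : nat) (r : int) (k : V), [/\ (0 < N)%N, sigma k = 0
    & order_bounded P u (g *+ N - u *~ r - k) (N%:R / M%:R : R)].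
Proof.
move=> tfV uP sgood g M M0; have [P0 PD] := cP.
have su := trace_gt0 sigma uP.
have MR : 0 < M%:R :> R by rewrite ltr0n.
pose f := Num.floor (sigma g * M%:R / sigma u).
pose s := tensor_trace sigma (rat_trace R).
have sE x q : s (tens x q) = sigma x * ratr q by exact: tensor_traceE.
pose a' : tensor V rat := tens g 1 - tens u (f%:~R / M%:R).
have sa' : s a' = sigma g - sigma u * (f%:~R / M%:R).
  by rewrite raddfB /= !sE rmorph1 mulr1 fmorph_div/= ratr_int ratr_nat.
have a'_itv : 0 <= s a' <= s (tens u M%:R^-1).
  rewrite sa' sE fmorphV/= ratr_nat.
  have -> : sigma g - sigma u * (f%:~R / M%:R) =
      sigma u / M%:R * (sigma g * M%:R / sigma u - f%:~R).
    by field; rewrite !gt_eqF.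
  have := floor_itv (sigma g * M%:R / sigma u).
  rewrite -/f intrD => /andP[fl fu].
  apply/andP; split; first by rewrite mulr_ge0 ?subr_ge0// divr_ge0// ltW.
  by rewrite ger_pMr ?divr_gt0// lerBlDl ltW// addrC.
have [a [Ta Tb sa]] := sgood _ _ (order_unit_tens_rat M0 uP) a'_itv.
have [n [a0 [n0 Pa0 na]]] := tensor_cone_rat Ta.
have [l [c0 [l0 Pc0 lc]]] := tensor_cone_rat Tb.
(* The inequality a <= u (x) 1/M, brought back to [V] by injectivity of x |-> x (x) 1. *)
have ac : u *+ (n * l) - a0 *+ (l * M) = c0 *+ (n * M).
  apply/eqP; rewrite -subr_eq0; apply/eqP/tens_rat1_inj => //.
  rewrite !(tensDl, tensNl, tensMnl) [tens a0 1 *+ _]mulrnA [tens c0 1 *+ _]mulrnA.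
  have uM : tens u (1 : rat) = tens u M%:R^-1 *+ M.
    by rewrite -tensMnr -[_^-1 *+ M]mulr_natr mulVf// pnatr_eq0 -lt0n.
  by rewrite uM -na -lc; zmodule.
(* The kernel element is n M times g - (f / M) u - a, so the error is M a0, which [ac] bounds by n
   u. *)
exists (n * M)%N, (f * n%:Z), (g *+ (n * M) - u *~ (f * n%:Z) - a0 *+ M); split.
- by rewrite muln_gt0 n0.
- have sa0 : sigma a0 = s a *+ n.
    by rewrite -raddfMn na sE rmorph1 mulr1.
  rewrite !raddfB raddfMz !raddfMn /= sa0 sa sa'.
  by field; rewrite gt_eqF.
- rewrite subKr natrM mulfK ?gt_eqF//.
  exists l, (n * l)%N; split=> //; first by rewrite natrM.
    rewrite (_ : _ - _ = c0 *+ (n * M)); first exact: convex_coneMn.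
    by rewrite -ac; zmodule.
  by apply: PD; do ?apply: convex_coneMn => //; exact: uP.1.
Qed.

End DivisibleHull.

(** * Kernels of product traces *)

Lemma natr_inv_le (R : realType) (e : R) : 0 < e ->
  exists2 n : nat, (0 < n)%N & n%:R^-1 <= e.
Proof.
move=> e0; exists (Num.bound e^-1).+1 => //.
rewrite invf_ple ?posrE ?ltr0n// ltW// (lt_trans (archi_boundP _))//.
  by rewrite invr_ge0 ltW.
by rewrite ltr_nat.
Qed.

Lemma order_bounded_division (R : realType) (V : zmodType) (P : set V)
    (u : V) :
  convex_cone P -> unperforated P -> order_unit P u ->
  approximately_divisible R P u ->
  forall (g : V) (n : nat) (e : R), (0 < n)%N -> 0 < e ->
  exists h, order_bounded P u (g - h *+ n) e.
Proof.
move=> cP Punp uP uad g n e n0 /natr_inv_le[L L0 Le].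
have [h [hl hr]] := approximate_division cP Punp uP uad g n0 L0 uP.
by exists h, L, 1%N; split; rewrite // -ler_pdivrMr ?ltr0n// div1r.
Qed.

Section TensorTraceGood.
Variables (R : realType) (G H : zmodType) (P : set G) (Q : set H).
Variables (u : G) (v : H) (sigma : trace R P) (tau : trace R Q).
Hypotheses (dP : dimension_group P) (uP : order_unit P u).
Hypothesis uad : approximately_divisible R P u.
Hypotheses (dQ : dimension_group Q) (vQ : order_unit Q v).
Hypothesis vad : approximately_divisible R Q v.
Hypothesis sgood : order_unit_good (tensor_trace sigma (rat_trace R)).
Hypothesis tgood : order_unit_good (tensor_trace tau (rat_trace R)).

Let cP := dimension_group_cone dP.
Let cQ := dimension_group_cone dQ.
Let T := tensor_cone P Q.
Let cT : convex_cone T := tensor_cone_convex P Q.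
Let t := tensor_trace sigma tau.
Let w := tens u v.
Let bounded : tensor G H -> R -> Prop := order_bounded T w.

Let tE g h : t (tens g h) = sigma g * tau h.
Proof. exact: tensor_traceE. Qed.

Let Tw : T w. Proof. by apply: tensor_cone_tens; [exact: uP.1|exact: vQ.1]. Qed.

Let tw0 : 0 < t w.
Proof. by rewrite tE mulr_gt0// ?(trace_gt0 sigma uP) ?(trace_gt0 tau vQ). Qed.

Let u1 : order_bounded P u u (1 : R).
Proof. by have := order_bounded_mulz R cP 1 uP.1. Qed.

Let v1 : order_bounded Q v v (1 : R).
Proof. by have := order_bounded_mulz R cQ 1 vQ.1. Qed.

Definition divisible_kernel (x : tensor G H) : Prop := t x = 0 /\
  forall (n : nat) (e : R), (0 < n)%N -> 0 < e ->
    exists y, t y = 0 /\ bounded (x - y *+ n) e.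

Lemma divisible_kernelD x y :
  divisible_kernel x -> divisible_kernel y -> divisible_kernel (x + y).
Proof.
move=> [x0 xd] [y0 yd]; split=> [|n e n0 e0]; first by rewrite raddfD x0 y0 addr0.
have e20 : 0 < e / 2 by rewrite divr_gt0.
have [x' [x'0 x'd]] := xd n _ n0 e20; have [y' [y'0 y'd]] := yd n _ n0 e20.
exists (x' + y'); split; first by rewrite raddfD x'0 y'0 addr0.
rewrite (_ : _ - _ = (x - x' *+ n) + (y - y' *+ n)); last by zmodule.
by rewrite [e]splitr; apply: order_boundedD.
Qed.

Lemma divisible_kernel0 : divisible_kernel 0.
Proof.
split=> [|n e _ e0]; first exact: raddf0.
exists 0; split; first exact: raddf0.
apply: (order_boundedW (ltW e0)).
have := order_bounded_mulz R cT 0 Tw.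
by rewrite mulr0z mul0rn subrr.
Qed.

Lemma divisible_kernelMn x n : divisible_kernel x -> divisible_kernel (x *+ n).
Proof.
move=> xd; elim: n => [|n IHn]; first by rewrite mulr0n; exact: divisible_kernel0.
by rewrite mulrS; apply: divisible_kernelD.
Qed.

(** Dividing the factor h approximately leaves g untouched, so the quotient stays exactly in the
    kernel. *)
Lemma divisible_kernel_tensl g h : sigma g = 0 -> divisible_kernel (tens g h).
Proof.
move=> g0; split=> [|n e n0 e0]; first by rewrite tE g0 mul0r.
have [K gK] := order_bounded_order_unit R cP g uP.
(* The successor is there because [K] may be 0. *)
have eK : 0 < e / K.+1%:R by rewrite divr_gt0.
have [h' hh'] :=
  order_bounded_division cQ (dimension_group_unperforated dQ) vQ vad h n0 eK.
exists (tens g h'); split; first by rewrite tE g0 mul0r.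
rewrite (_ : _ - _ = tens g (h - h' *+ n)); last by rewrite !tensE.
have := order_bounded_tens gK hh'; apply: order_boundedW => //.
rewrite mulrCA ger_pMr// ler_pdivrMr// mul1r ler_nat//.
Qed.

Lemma divisible_kernel_tensr g h : tau h = 0 -> divisible_kernel (tens g h).
Proof.
move=> h0; split=> [|n e n0 e0]; first by rewrite tE h0 mulr0.
have [K hK] := order_bounded_order_unit R cQ h vQ.
have eK : 0 < e / K.+1%:R by rewrite divr_gt0.
have [g' gg'] :=
  order_bounded_division cP (dimension_group_unperforated dP) uP uad g n0 eK.
exists (tens g' h); split; first by rewrite tE h0 mulr0.
rewrite (_ : _ - _ = tens (g - g' *+ n) h); last by rewrite !tensE.
have := order_bounded_tens gg' hK; apply: order_boundedW => //.
rewrite -mulrA ger_pMr// mulrC ler_pdivrMr// mul1r ler_nat//.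
Qed.

(* In the divisible hull, x is within any e of a multiple of w plus an element
   of the kernel. *)
Definition near_kernel (x : tensor G H) : Prop := forall e : R, 0 < e ->
  exists n (r : int) k, [/\ (0 < n)%N, divisible_kernel k
    & bounded (x *+ n - w *~ r - k) (n%:R * e)].

Lemma near_kernelD x y : near_kernel x -> near_kernel y -> near_kernel (x + y).
Proof.
move=> xk yk e e0; have e20 : 0 < e / 2 by rewrite divr_gt0.
have [n [r [k [n0 kd xn]]]] := xk _ e20.
have [m [s [l [m0 ld ym]]]] := yk _ e20.
exists (n * m)%N, (r * m + s * n), (k *+ m + l *+ n); split.
- by rewrite muln_gt0 n0.
- by apply: divisible_kernelD; apply: divisible_kernelMn.
rewrite (_ : _ - _ = (x *+ n - w *~ r - k) *+ m + (y *+ m - w *~ s - l) *+ n).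
  rewrite (_ : _ * e = m%:R * (n%:R * (e / 2)) + n%:R * (m%:R * (e / 2))).
    by apply: order_boundedD; rewrite //; apply: order_boundedMn.
  by rewrite natrM; field.
by zmodule.
Qed.

(** Allows a reduction in two stages: g (x) h is first brought to a multiple of u (x) h through the
    left factor, then to a multiple of w through the right one. *)
Lemma near_kernel_step x :
  (forall e, 0 < e -> exists n z k, [/\ (0 < n)%N, near_kernel z,
    divisible_kernel k & bounded (x *+ n - z - k) (n%:R * e)]) -> near_kernel x.
Proof.
move=> xk e e0; have e20 : 0 < e / 2 by rewrite divr_gt0.
have [n [z [k [n0 zk kd xn]]]] := xk _ e20.
have [m [r [l [m0 ld zm]]]] := zk _ e20.
exists (n * m)%N, r, (k *+ m + l); split.
- by rewrite muln_gt0 n0.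
- by apply: divisible_kernelD => //; apply: divisible_kernelMn.
rewrite (_ : _ - _ = (x *+ n - z - k) *+ m + (z *+ m - w *~ r - l)).
  apply: (@order_boundedW _ _ _ _ _ (m%:R * (n%:R * (e / 2)) + m%:R * (e / 2))).
    rewrite -subr_ge0 (_ : _ - _ = m%:R * (e / 2) * (n%:R - 1)).
      by rewrite mulr_ge0 ?subr_ge0 ?ler1n// mulr_ge0// ltW.
    by rewrite natrM; field.
  by apply: order_boundedD => //; apply: order_boundedMn.
by zmodule.
Qed.

Lemma near_kernel_unit h : near_kernel (tens u h).
Proof.
move=> e /natr_inv_le[M M0 Me].
have [n [r [l [n0 l0 hn]]]] :=
  trace_decomposition cQ (dimension_group_torsion_free dQ) vQ tgood h M0.
exists n, r, (tens u l); split=> //; first exact: divisible_kernel_tensr.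
rewrite (_ : _ - _ = tens u (h *+ n - v *~ r - l)); last by rewrite !tensE.
have := order_bounded_tens u1 hn; apply: order_boundedW => //.
by rewrite mul1r ler_wpM2l.
Qed.

Lemma near_kernel_tens g h : near_kernel (tens g h).
Proof.
apply: near_kernel_step => e e0.
have [K hK] := order_bounded_order_unit R cQ h vQ.
have /natr_inv_le[M M0 Me] : 0 < e / K.+1%:R by rewrite divr_gt0.
have [n [r [k [n0 k0 gn]]]] :=
  trace_decomposition cP (dimension_group_torsion_free dP) uP sgood g M0.
exists n, (tens u (h *~ r)), (tens k h); split=> //.
- exact: near_kernel_unit.
- exact: divisible_kernel_tensl.
rewrite (_ : _ - _ = tens (g *+ n - u *~ r - k) h); last by rewrite !tensE.
have := order_bounded_tens gn hK; apply: order_boundedW => //.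
rewrite -mulrA ler_wpM2l//.
have := ler_wpM2r (ler0n R K) Me; move/le_trans; apply.
rewrite -mulrA ger_pMr// mulrC ler_pdivrMr// mul1r ler_nat//.
Qed.

Lemma near_kernel_all x : near_kernel x.
Proof.
by elim/tensor_ind: x => [g h|x y]; [exact: near_kernel_tens|exact: near_kernelD].
Qed.

(** Write n x as r w plus a divisible kernel element plus a small error. Taking traces bounds |r| by
    about n |t x| / t w. The kernel element is divided by n q, as the whole estimate is divided by n
    at the end. *)
Lemma kernel_approximation (x : tensor G H) (q : nat) (e : R) :
  (0 < q)%N -> 0 < e ->
  exists k, t k = 0 /\ bounded (x - k *+ q) (`|t x| / t w + e).
Proof.
move=> q0 e0; have e30 : 0 < e / 3 by rewrite divr_gt0.
have [n [r [k [n0 [k0 kd] xn]]]] := near_kernel_all x e30.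
have nq0 : (0 < n * q)%N by rewrite muln_gt0 n0.
have [l [l0 kl]] := kd _ _ nq0 e30.
exists l; split=> //.
apply: (@order_bounded_divn _ _ _ _ _ _ n n0).
have rn : `|r|%N%:R <= n%:R * (`|t x| / t w + e / 3).
  have := order_bounded_trace t Tw xn.
  rewrite !raddfB raddfMz raddfMn /= k0 subr0 => xr.
  rewrite -(ler_pM2r tw0).
  have -> : n%:R * (`|t x| / t w + e / 3) * t w =
      n%:R * `|t x| + n%:R * (e / 3) * t w by field; rewrite gt_eqF.
  have -> : `|r|%N%:R * t w = `|t w *~ r|.
    by rewrite -mulrzl normrM (gtr0_norm tw0) natr_absz intr_norm.
  rewrite -[_ *~ r](subKr (t x *+ n)) mulr_natl -normrMn.
  by apply: le_trans (ler_normB _ _) _; rewrite lerD2l.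
rewrite (_ : _ *+ n = (x *+ n - w *~ r - k) + (k - l *+ (n * q)) + w *~ r).
  apply: (@order_boundedW _ _ _ _ _ (n%:R * (e / 3) + e / 3 + `|r|%N%:R)).
    rewrite -lerBrDl; apply: le_trans rn _; rewrite -subr_ge0.
    rewrite (_ : _ - _ = (n%:R - 1) * (e / 3)); last by field; rewrite gt_eqF.
    by rewrite mulr_ge0 ?subr_ge0 ?ler1n// ltW.
  apply: order_boundedD => //; first exact: order_boundedD.
  exact: order_bounded_mulz.
by zmodule.
Qed.

(* Here a is close to (p / q) b, and b dominates w / K. *)
Lemma tensor_cone_near_multiple (b a : tensor G H) (K p q : nat) (e : R) :
  (0 < K)%N -> (0 < q)%N -> T (b *+ K - w) -> K%:R * e < p%:R ->
  bounded (a *+ q - b *+ p) e -> T a.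
Proof.
move=> K0 q0 bK Kep [m [k [m0 ke _ akb]]].
have kmp : (k * K < m * p)%N.
  rewrite -(ltr_nat R) !natrM; apply: (@le_lt_trans _ _ (m%:R * (K%:R * e))).
    by rewrite mulrC mulrCA ler_wpM2l// mulrC.
  by rewrite ltr_pM2l// ltr0n.
apply: (tensor_cone_almost_unperforated cP (dimension_group_unperforated dP)
  uP uad cQ (dimension_group_torsion_free dQ) vQ (n := m * q * K)).
  by rewrite !muln_gt0 m0 q0.
(* The strict inequality k K < m p leaves one spare copy of w, the one required by almost
   unperforation. *)
rewrite (_ : _ - _ = (w *+ k + (a *+ q - b *+ p) *+ m) *+ K
  + (b *+ K - w) *+ (m * p) + w *+ (m * p - (k * K).+1)).
  apply: cT.2; last exact: convex_coneMn.
  by apply: cT.2; apply: convex_coneMn.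
rewrite [w *+ (_ - _)]mulrnBr//; zmodule.
Qed.

Lemma tensor_trace_order_unit_good : order_unit_good t.
Proof.
move=> b a' bT /andP[]; rewrite le_eqVlt => /predU1P[a'0 _|a'0].
  exists 0; split; first exact: cT.1; last by rewrite raddf0.
  by rewrite /cone_le subr0; exact: bT.1.
rewrite le_eqVlt => /predU1P[a'b|a'b].
  by exists b; split=> //; [exact: bT.1|rewrite /cone_le subrr; exact: cT.1].
have [K [K0 bK]] := order_unit_ub w bT.
have tb0 : 0 < t b by apply: lt_trans a'b.
pose c := t a' / t b.
have c0 : 0 < c by rewrite divr_gt0.
have c1 : c < 1 by rewrite ltr_pdivrMr// mul1r.
(* [E] bounds the error for every q: as p is the integer part of c q, the trace of q a' - p b lies
   between 0 and t b. *)
pose E := t b / t w + 1.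
pose d := Num.min c (1 - c).
have d0 : 0 < d by rewrite lt_min c0 subr_gt0.
have E0 : 0 < E by rewrite addr_gt0// divr_gt0.
have KE0 : 0 <= (K%:R * E + 1) / d.
  by rewrite divr_ge0 ?(ltW d0)// addr_ge0// mulr_ge0// ltW.
(* With q this large both p and q - p exceed K E; the summand 1 makes up for rounding c q down to
   p. *)
pose q := Num.bound ((K%:R * E + 1) / d).
have : (K%:R * E + 1) / d < q%:R by exact: archi_boundP.
rewrite ltr_pdivrMr// => dq.
have q0 : (0 < q)%N.
  rewrite lt0n; apply/eqP => q0; move: dq; rewrite q0 mul0r ltNge => /negP; apply.
  by rewrite addr_ge0// mulr_ge0// ltW.
have cq0 : 0 <= c * q%:R by rewrite mulr_ge0// ltW.
pose p := Num.trunc (c * q%:R).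
have /andP[pc cp] : p%:R <= c * q%:R < p.+1%:R by exact: truncn_itv.
have cd : q%:R * d <= q%:R * c by rewrite ler_wpM2l// ge_min lexx.
have c1d : q%:R * d <= q%:R * (1 - c) by rewrite ler_wpM2l// ge_min lexx orbT.
have KEp : K%:R * E < p%:R by move: cp; rewrite -natr1; lra.
have KEqp : K%:R * E < q%:R - p%:R by lra.
have pq : (p <= q)%N by rewrite -(ler_nat R); have := mulr_ge0 (ler0n R K) (ltW E0); lra.
have [k [k0 kE]] := kernel_approximation (a' *+ q - b *+ p) q0 ltr01.
have {}kE : bounded (a' *+ q - b *+ p - k *+ q) E.
  apply: order_boundedW kE; rewrite lerD2r ler_pM2r ?invr_gt0//.
  have -> : t (a' *+ q - b *+ p) = t b * (c * q%:R - p%:R).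
    transitivity (t a' *+ q - t b *+ p); first by rewrite raddfB !raddfMn.
    by rewrite /c; field; rewrite gt_eqF.
  rewrite normrM gtr0_norm// ger_pMr// ger0_norm ?subr_ge0//.
  by move: cp; rewrite -natr1; lra.
(* Here q a is within E w of p b and q (b - a) within E w of (q - p) b, so both are positive by
   [tensor_cone_near_multiple]. *)
exists (a' - k); split; last by rewrite raddfB k0 subr0.
- apply: (@tensor_cone_near_multiple b _ K p q E) => //.
  by rewrite (_ : _ - _ = a' *+ q - b *+ p - k *+ q)//; zmodule.
- apply: (@tensor_cone_near_multiple b _ K (q - p) q E) => //; first by rewrite natrB.
  rewrite (_ : _ - _ = - (a' *+ q - b *+ p - k *+ q)); first exact: order_boundedN.
  by rewrite mulrnBr//; zmodule.
Qed.

End TensorTraceGood.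

Theorem proposition2p1 (R : realType) (G H : zmodType)
    (Gpos : set G) (Hpos : set H) (u : G) (v : H)
    (sigma : trace R Gpos) (tau : trace R Hpos) :
  dimension_group Gpos -> order_unit Gpos u -> approximately_divisible R Gpos u ->
  dimension_group Hpos -> order_unit Hpos v -> approximately_divisible R Hpos v ->
  order_unit_good (tensor_trace sigma (rat_trace R)) ->
  order_unit_good (tensor_trace tau (rat_trace R)) ->
  order_unit_good (tensor_trace sigma tau).

Proof.
move=> dP uP uad dQ vQ vad sgood tgood.
exact: tensor_trace_order_unit_good dP uP uad dQ vQ vad sgood tgood.
Qed.
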